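(* On the exceptional tube domain there exists no theta series satisfying the identities (T1)--(T5) of the context. That is: if $V$ is the 27-dimensional exceptional simple formally real Jordan algebra (Hermitian $3\times3$ matrices over the octonions) and $Y_{\mathrm{exc}}\subset V$ is the cone of all squares of its invertible elements, then there are no data $\widehat U,\rho,\psi,e$ as in the context with $Y=Y_{\mathrm{exc}}$, together with $j,J,H,(c_\Lambda)_\Lambda$, such that the associated theta series satisfies (T1)--(T5).
   Context: All vector spaces are finite-dimensional. $\widehat U\neq\{0\}$ is a real vector space with complexification $U=\widehat U^{\mathbb C}$; $\rho$ is a positive definite symmetric bilinear form on $\widehat U$, extended $\mathbb C$-bilinearly to $U$; $B^\rho$ denotes the adjoint of $B$ with respect to $\rho$. For a full-rank lattice $\Lambda\subset\widehat U$, $\Lambda^\rho=\{x\in\widehat U:\rho(\Lambda,x)\subseteq\mathbb Z\}$ is the dual lattice. $V$ is a real vector space with complexification $V^{\mathbb C}$, and $\psi:V^{\mathbb C}\to\mathrm{End}_{\mathbb C}(U)$ is an injective $\mathbb C$-linear map such that for every $x\in V$ the map $\psi(x)$ sends $\widehat U$ to itself and is self-adjoint with respect to $\rho$. Put $Y=\{x\in V:\rho(\psi(x)u,u)>0\text{ for all }u\in\widehat U\setminus\{0\}\}$; it is assumed that $Y\neq\emptyset$, and then $Y$ is an open convex cone in $V$ which is regular (contains no full line). A base point $e\in Y$ with $\psi(e)=I$ is fixed. $\mathcal H(Y)=V\oplus iY\subset V^{\mathbb C}$ is the tube domain over $Y$. For a full-rank lattice $\Lambda$ in $\widehat U$ the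 theta series is $$\theta_\Lambda(z,u)=\sum_{l\in\Lambda^\rho}\exp\bigl(\pi i\,\rho(\psi(z)l+2u,l)\bigr),\qquad (z,u)\in\mathcal H(Y)\times U,$$ which converges absolutely; thus in $\theta_{\Lambda^\rho}$ the sum is over $(\Lambda^\rho)^\rho=\Lambda$. The identities, for every full-rank lattice $\Lambda\subset\widehat U$ and all $(z,u)\in\mathcal H(Y)\times U$, are: (T1) $\theta_\Lambda(z,u+m)=\theta_\Lambda(z,u)$ for all $m\in\Lambda$. (T2) $\theta_\Lambda(z,u+\psi(z)n)=\exp(-\pi i\,\rho(\psi(z)n+2u,n))\,\theta_\Lambda(z,u)$ for all $n\in\Lambda^\rho$. (T3) $\theta_\Lambda(z+k,u)=\theta_\Lambda(z,u)$ for all $k\in\mathcal L=\{x\in V:\rho(\psi(x)l,l)\in2\mathbb Z\text{ for all }l\in\Lambda^\rho\}$. (T4) $\theta_{\widehat W\Lambda}(Wz,\widehat Wu)=\theta_\Lambda(z,u)$ for all $W\in GL(V)$, $\widehat W\in GL(\widehat U)$ with $\psi(Wx)=\widehat W\psi(x)\widehat W^\rho$ for all $x\in V^{\mathbb C}$. (T5) (theta transformation formula) $\theta_{\Lambda^\rho}(j(z),J(z)u)=c_\Lambda\cdot H(z,u)\cdot\theta_\Lambda(z,u)$, where: $j:\mathcal H(Y)\to\mathcal H(Y)$ is a non-affine holomorphic map with $j\circ j=\mathrm{id}$, $j(ie)=ie$ and derivative $dj(ie)=-I$; $J:\mathcal H(Y)\to\mathrm{End}(U)$ is holomorphic; $H:\mathcal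 H(Y)\times U\to\mathbb C$ is holomorphic, without zeros, and normalized by $H(ie,0)=1$; $j,J,H$ are independent of $\Lambda$; and $c_\Lambda$ is a constant depending only on $\Lambda$. *)

(* Defs.v *)
From HB Require Import structures.
From mathcomp Require Import all_boot all_order all_algebra.
From mathcomp Require Import all_classical all_reals all_analysis.
From mathcomp Require Import complex.
From mathcomp.analysis.showcase Require summability.

Set Implicit Arguments.
Unset Strict Implicit.
Unset Printing Implicit Defensive.

Import Order.TTheory GRing.Theory Num.Theory.
Import numFieldNormedType.Exports.

Local Open Scope classical_set_scope.
Local Open Scope ring_scope.

(* Vector spaces are handled in coordinates: a real vector space of dimension
   n is 'cV[R]_n, its complexification is 'cV[C R]_n, and endomorphisms are
   square matrices acting on the left of column vectors. *)

(* R[i] with its type declared as a numClosedFieldType, so that it inherits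
   the topology and normed-module structure of numeric fields; differentiability
   between normed modules over C R is then complex differentiability. *)
Definition C (R : realType) : numClosedFieldType := R[i].

Definition I_ (R : realType) : C R := (0 +i* 1)%C.

Definition complexify (R : realType) (m n : nat) (A : 'M[R]_(m, n)) :
    'M[C R]_(m, n) :=
  map_mx (real_complex R) A.

Definition cexp (R : realType) (z : C R) : C R :=
  ((expR (complex.Re z) * cos (complex.Im z))
     +i* (expR (complex.Re z) * sin (complex.Im z)))%C.

(* exp(pi i w) *)
Definition exp_ipi (R : realType) (w : C R) : C R :=
  cexp ((real_complex R pi : C R) * I_ R * w).

(* The bilinear form with Gram matrix G.  A real form rho has a real Gram
   matrix G; its C-bilinear extension has Gram matrix complexify G. *)
Definition form (K : fieldType) (n : nat) (G : 'M[K]_n) (u v : 'cV[K]_n) : K :=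
  (u^T *m G *m v) 0 0.

Definition formC (R : realType) (n : nat) (G : 'M[R]_n) (u v : 'cV[C R]_n) :
    C R :=
  form (complexify G) u v.

Definition adjoint (K : fieldType) (n : nat) (G B : 'M[K]_n) : 'M[K]_n :=
  invmx G *m B^T *m G.

Lemma adjointP (K : fieldType) (n : nat) (G B : 'M[K]_n) (u v : 'cV[K]_n) :
  G \in unitmx -> form G (B *m u) v = form G u (adjoint G B *m v).
Proof.
move=> Gu; rewrite /form /adjoint trmx_mul; congr (_ 0 0).
by rewrite -!mulmxA; congr (_ *m _); rewrite !mulmxA mulmxV // mul1mx.
Qed.

Definition full_lattice (R : realType) (n : nat) (L : set 'cV[R]_n) : Prop :=
  exists2 B : 'M[R]_n, B \in unitmx &
    L = [set B *m map_mx intr k | k in [set: 'cV[int]_n]].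

Definition dual_lattice (R : realType) (n : nat) (G : 'M[R]_n)
    (L : set 'cV[R]_n) : set 'cV[R]_n :=
  [set x | forall l, L l -> form G l x \is a Num.int].

(* In C R the relation 0 < w means that w is real and positive. *)
Definition theta_cone (R : realType) (m n : nat) (G : 'M[R]_n)
    (psi : 'cV[C R]_m -> 'M[C R]_n) : set 'cV[R]_m :=
  [set x | forall u : 'cV[R]_n, u != 0 ->
     0 < formC G (psi (complexify x) *m complexify u) (complexify u)].

Definition tube (R : realType) (m : nat) (Y : set 'cV[R]_m) :
    set 'cV[C R]_m :=
  [set z | Y (map_mx (@complex.Im R) z)].

Record theta_data (R : realType) (m n : nat) (G : 'M[R]_n)
    (psi : {linear 'cV[C R]_m -> 'M[C R]_n}) (e : 'cV[R]_m) : Prop :=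
  ThetaData {
    dim_pos : (0 < n)%N;
    rho_sym : G^T = G;
    rho_pos : forall u : 'cV[R]_n, u != 0 -> 0 < form G u u;
    psi_inj : injective psi;
    psi_self_adjoint : forall x : 'cV[R]_m,
      exists2 A : 'M[R]_n, psi (complexify x) = complexify A & adjoint G A = A;
    base_in_cone : theta_cone G psi e;
    psi_base : psi (complexify e) = 1%:M
  }.

(* The sum is the limit of the finite partial sums along the directed set of
   finite subsets of the index set. *)
Definition theta (R : realType) (m n : nat) (G : 'M[R]_n)
    (psi : 'cV[C R]_m -> 'M[C R]_n) (L : set 'cV[R]_n)
    (z : 'cV[C R]_m) (u : 'cV[C R]_n) : C R :=
  summability.sum (fun l : 'cV[R]_n =>
    if l \in dual_lattice G L then
      exp_ipi (formC G (psi z *m complexify l + u *+ 2) (complexify l))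
    else 0).

Section Identities.
Context (R : realType) (m n : nat) (G : 'M[R]_n).
Context (psi : 'cV[C R]_m -> 'M[C R]_n) (e : 'cV[R]_m).

Let H_Y := tube (theta_cone G psi).

Definition identity_T1 : Prop :=
  forall L z u, full_lattice L -> H_Y z ->
  forall v, L v ->
    theta G psi L z (u + complexify v) = theta G psi L z u.

Definition identity_T2 : Prop :=
  forall L z u, full_lattice L -> H_Y z ->
  forall v, dual_lattice G L v ->
    theta G psi L z (u + psi z *m complexify v) =
    exp_ipi (- formC G (psi z *m complexify v + u *+ 2) (complexify v)) *
      theta G psi L z u.

Definition even_periods (L : set 'cV[R]_n) : set 'cV[R]_m :=
  [set x | forall l, dual_lattice G L l ->
     exists k : int,
       formC G (psi (complexify x) *m complexify l) (complexify l) =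
       (k * 2)%:~R].

Definition identity_T3 : Prop :=
  forall L z u, full_lattice L -> H_Y z ->
  forall k, even_periods L k ->
    theta G psi L (z + complexify k) u = theta G psi L z u.

Definition identity_T4 : Prop :=
  forall L z u, full_lattice L -> H_Y z ->
  forall (W : 'M[R]_m) (W' : 'M[R]_n), W \in unitmx -> W' \in unitmx ->
    (forall x : 'cV[C R]_m,
       psi (complexify W *m x) =
       complexify W' *m psi x *m complexify (adjoint G W')) ->
    theta G psi [set W' *m l | l in L] (complexify W *m z)
      (complexify W' *m u) = theta G psi L z u.

Let ie : 'cV[C R]_m := I_ R *: complexify e.

(* The total functions j, J, Hfac stand for maps defined on the tube domain
   only: nothing is required of their values outside the (open) tube. *)
Record identity_T5 (j : 'cV[C R]_m -> 'cV[C R]_m)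
    (J : 'cV[C R]_m -> 'M[C R]_n)
    (Hfac : 'cV[C R]_m -> 'cV[C R]_n -> C R)
    (c : set 'cV[R]_n -> C R) : Prop := IdentityT5 {
  j_tube : forall z, H_Y z -> H_Y (j z);
  j_holo : forall z, H_Y z -> differentiable j z;
  j_nonaffine : ~ exists (A : 'M[C R]_m) (b : 'cV[C R]_m),
    forall z, H_Y z -> j z = A *m z + b;
  j_invol : forall z, H_Y z -> j (j z) = z;
  j_fix : j ie = ie;
  j_diff : forall v : 'cV[C R]_m, 'd j ie v = - v;
  J_holo : forall z, H_Y z -> differentiable J z;
  Hfac_holo : forall z u, H_Y z ->
    differentiable (fun p : 'cV[C R]_m * 'cV[C R]_n => Hfac p.1 p.2) (z, u);
  Hfac_neq0 : forall z u, H_Y z -> Hfac z u != 0;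
  Hfac_norm : Hfac ie 0 = 1;
  theta_transform : forall L z u, full_lattice L -> H_Y z ->
    theta G psi (dual_lattice G L) (j z) (J z *m u) =
    c L * Hfac z u * theta G psi L z u
}.

End Identities.

(* One step of the Cayley-Dickson doubling process. *)
Definition cd_conj (A : zmodType) (conj : A -> A) (x : A * A) : A * A :=
  (conj x.1, - x.2).

Definition cd_mul (A : zmodType) (conj : A -> A) (mul : A -> A -> A)
    (x y : A * A) : A * A :=
  (mul x.1 y.1 - mul (conj y.2) x.2, mul y.2 x.1 + mul x.2 (conj y.1)).

Definition octonion (R : realType) : lmodType R :=
  (((R * R) * (R * R)) * ((R * R) * (R * R)))%type.

Definition oconj (R : realType) : octonion R -> octonion R :=
  cd_conj (cd_conj (cd_conj (@id R))).

Definition omul (R : realType) : octonion R -> octonion R -> octonion R :=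
  cd_mul (cd_conj (cd_conj (@id R)))
    (cd_mul (cd_conj (@id R)) (cd_mul (@id R) *%R)).

Definition oreal (R : realType) (a : R) : octonion R :=
  (((a, 0), (0, 0)), ((0, 0), (0, 0))).

Definition omulmx (R : realType) (A B : 'M[octonion R]_3) :
    'M[octonion R]_3 :=
  \matrix_(i, j) \sum_k omul (A i k) (B k j).

Definition jordan_mul (R : realType) (A B : 'M[octonion R]_3) :
    'M[octonion R]_3 :=
  2^-1 *: (omulmx A B + omulmx B A).

Definition jordan_one (R : realType) : 'M[octonion R]_3 :=
  \matrix_(i, j) oreal (i == j)%:R.

(* Coordinates k, k + 1, up to k + 7 of x. *)
Definition ocoord (R : realType) (x : 'cV[R]_27) (k : nat) : octonion R :=
  let a i := x (inord (k + i)) 0 in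
  (((a 0%N, a 1%N), (a 2%N, a 3%N)), ((a 4%N, a 5%N), (a 6%N, a 7%N))).

(* The linear bijection of R^27 with the Hermitian 3 x 3 octonion matrices:
   coordinates 0, 1, 2 are the diagonal entries, and the entries (0,1), (0,2),
   (1,2) above the diagonal are read from coordinate 3, 11, 19 on. *)
Definition albert (R : realType) (x : 'cV[R]_27) : 'M[octonion R]_3 :=
  \matrix_(i, j)
    if i == j then oreal (x (inord i) 0)
    else if (i < j)%N then ocoord x (3 + 8 * (i + j).-1)
    else oconj (ocoord x (3 + 8 * (i + j).-1)).

(* Invertibility in a unital Jordan algebra: y o z = 1 and y^2 o z = y. *)
Definition jordan_invertible (R : realType) (y : 'cV[R]_27) : Prop :=
  exists z : 'cV[R]_27,
    jordan_mul (albert y) (albert z) = jordan_one R /\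
    jordan_mul (jordan_mul (albert y) (albert y)) (albert z) = albert y.

Definition exceptional_cone (R : realType) : set 'cV[R]_27 :=
  [set x | exists2 y : 'cV[R]_27, jordan_invertible y &
     albert x = jordan_mul (albert y) (albert y)].
Arguments exceptional_cone R : clear implicits.

(* Main.v *)
Require Import Defs.
From HB Require Import structures.
From mathcomp Require Import all_boot all_order all_algebra finmap.
From mathcomp Require Import all_classical all_reals all_analysis.
From mathcomp Require Import complex.
From mathcomp.analysis.showcase Require summability.
From mathcomp Require Import ring lra.
Import Order.TTheory GRing.Theory Num.Theory.
Import numFieldNormedType.Exports.
Import Defs.
Local Open Scope classical_set_scope.
Local Open Scope ring_scope.

Set Implicit Arguments.
Unset Strict Implicit.
Unset Printing Implicit Defensive.

(** Suppose such data exist, and write Z = psi(z), Z' = psi(j(z)), J = J(z).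

    The transformation formula forces psi(j(z)) to be a nonzero multiple of
    psi(z)^-1, as for the classical theta function.  The only analytic fact
    needed is that a theta series whose summation lattice is dilated by t tends
    to 1 as t grows (theta_dual_sparse).  Taking this limit in (T5), with (T2)
    applied to a fixed vector v that stays in the dual lattices, shows that H
    itself satisfies the quasi-periodicity H(z,u) = E(v,u) H(z,u + Zv) for all
    real vectors v, where E is the exponential factor of (T2) (H_cocycle).
    Applying (T5) twice, together with j o j = id, gives that
    H(j(z),Ju) H(z,u) does not depend on u (H_involution).  These two facts make
    J(z) invertible (J_unit).  The function u |-> theta(j(z),Ju) has on the one
    hand the periods Zv and on the other hand the quasi-periods J^-1 Z'l;
    comparing the two orders in which they can be applied shows that
    rho(JZv,l) is an integer for every lattice containing l with v in its dual
    (JZ_integral), whence JZ is a scalar (JZ_scalar).  Comparing in the same way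
    the two quasi-periodicities of H gives Z'Z = - (JZ)^2 (psi_j_psi).

    So the inverses of the operators psi(y) with y in Y are again in psi(Y)
    (real_op_inv).  By Hua's identity
    X - X C^-1 X = (X^-1 + (C - X)^-1)^-1, the real operators psi(x) with x in V
    are then closed under X |-> X C^-1 X, where C = psi(1) and 1 is the unit of
    the exceptional algebra (real_op_quadratic).  Hence M(x) = C^-1 psi(x) is a
    linear map into operators self-adjoint for a positive definite form, its
    image is closed under squaring, M(1) = 1, and M(x) is positive definite
    exactly when x is in the exceptional cone.

    It remains to see that no such M exists (albert_not_special).  Two facts
    about the cone are used: the minors of order at most two of an element of
    the cone are nonnegative (cone_minor), and the cone has in its closure the
    rank one matrices v v* with v = (p,a,b), p real (rank1_cone).  By the first
    one, the diagonal idempotents span extreme rays of the closed cone; as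
    M(e_i)^2 lies between 0 and M(e_i), it is a multiple of M(e_i), and the
    M(e_i) turn out to be orthogonal projections P_i with sum 1.  The elements
    with a single entry a off the diagonal go to operators exchanging the two
    corresponding blocks, with square |a|^2 times the projection on both blocks
    (offdiag_sq).  Positivity of the operator of v v* with v = (1,a,b) then says
    that a Schur complement with zero diagonal blocks is positive, so its
    off-diagonal block vanishes: this expresses the image of a b* as a product of
    the images of a* and b* (schur_product).  It follows that an injective linear
    map s satisfies s(ab) = s(a) K s(b) for a fixed K, and the octonions would be
    associative. *)

(** * Octonions *)

Definition onorm (R : realType) (x : octonion R) : R :=
  let: (((a, b), (c, d)), ((e, f), (g, h))) := x in
  a ^+ 2 + b ^+ 2 + c ^+ 2 + d ^+ 2 + e ^+ 2 + f ^+ 2 + g ^+ 2 + h ^+ 2.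

(** Octonion identities are polynomial identities in the eight real
    coordinates of each variable, so they are proved coordinate by coordinate
    with [ring]. *)
Ltac odestruct x :=
  let a := fresh in let b := fresh in let c := fresh in let d := fresh in
  let e := fresh in let f := fresh in let g := fresh in let h := fresh in
  destruct x as [[[a b] [c d]] [[e f] [g h]]].

Lemma rscaleE (R : realType) (a : R) (x : (R : lmodType R)) :
  a *: x = a * (x : R).
Proof. by []. Qed.

Ltac oring :=
  cbv beta iota delta [omul oconj oreal cd_mul cd_conj fst snd];
  repeat congr pair; rewrite /= ?rscaleE; ring.

Section Octonions.
Context (R : realType).
Implicit Types x y z : octonion R.

Lemma onorm_ge0 x : 0 <= onorm x.
Proof. by odestruct x; rewrite /= !addr_ge0 ?sqr_ge0. Qed.

Lemma onormM x y : onorm (omul x y) = onorm x * onorm y.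
Proof. odestruct x; odestruct y; rewrite /omul /cd_mul /cd_conj /=; ring. Qed.

Lemma oconjK x : oconj (oconj x) = x.
Proof. odestruct x. oring. Qed.

Lemma omulZl (a : R) x y : omul (a *: x) y = a *: omul x y.
Proof. odestruct x; odestruct y. oring. Qed.

Lemma omul_conj x : omul x (oconj x) = oreal (onorm x).
Proof. odestruct x. oring. Qed.

(** The witnesses are the imaginary units adjoined by the three successive
    doublings. *)
Lemma omul_nonassoc : exists x y z, omul (omul x y) z <> omul x (omul y z).
Proof.
have [t t0] : exists t : R, t = 0 by exists 0.
have [i i1] : exists i : R, i = 1 by exists 1.
exists (((t, i), (t, t)), ((t, t), (t, t))).
exists (((t, t), (i, t)), ((t, t), (t, t))).
exists (((t, t), (t, t)), ((i, t), (t, t))).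
move=> /(congr1 (fun x : octonion R => x.2.2.2)).
cbv beta iota delta [omul cd_mul cd_conj fst snd].
rewrite /= t0 i1 !(mulr0, mul0r, oppr0, addr0, add0r, mulr1, mul1r, subr0, sub0r).
lra.
Qed.
End Octonions.

(** * Hermitian octonion matrices in coordinates *)

Section Albert.
Context (R : realType).
Implicit Types x y z : octonion R.

(** Inverse of [albert] in coordinates: the diagonal entries p, q, r, then the
    entries a, b, c at the places (0,1), (0,2), (1,2). *)
Definition herm3 (p q r : R) (a b c : octonion R) : 'cV[R]_27 :=
  let l (x : octonion R) : seq R :=
    let: (((x0, x1), (x2, x3)), ((x4, x5), (x6, x7))) := x in
    [:: x0; x1; x2; x3; x4; x5; x6; x7] in
  \col_i ([:: p; q; r] ++ l a ++ l b ++ l c)`_i.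

Lemma albert_herm3 p q r a b c i j : albert (herm3 p q r a b c) i j =
  nth 0 (nth [::] [:: [:: oreal p; a; b]; [:: oconj a; oreal q; c];
     [:: oconj b; oconj c; oreal r]] i) j.
Proof.
odestruct a; odestruct b; odestruct c.
case: i => -[|[|[|//]]] hi; case: j => -[|[|[|//]]] hj;
  rewrite /albert mxE /=; congr oreal || congr oconj || idtac;
  rewrite /ocoord /herm3 !mxE ?inordK //.
Qed.

Lemma albert_inj : injective (@albert R).
Proof.
move=> x y; rewrite /albert => /matrixP e; apply/colP => k.
have d (i : 'I_3) : x (inord i) 0 = y (inord i) 0.
  by move: (e i i); rewrite !mxE eqxx => -[].
have o (i j : 'I_3) : (i < j)%N ->
    ocoord x (3 + 8 * (i + j).-1) = ocoord y (3 + 8 * (i + j).-1).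
  by move=> ij; move: (e i j); rewrite !mxE -val_eqE /= ltn_eqF // ij.
have kK : k = inord k by rewrite inord_val.
have [k3|k3] := ltnP k 3; first by have := d (Ordinal k3); rewrite /= -kK.
have u (i j : 'I_3) (m : nat) : (m < 8)%N -> (i < j)%N ->
    x (inord (3 + 8 * (i + j).-1 + m)) 0 = y (inord (3 + 8 * (i + j).-1 + m)) 0.
  move=> + /o []; rewrite ?addn0; case: m => [|[|[|[|[|[|[|[|//]]]]]]]] _ //;
   by rewrite ?addn0.
have [i [j [m [m8 ij km]]]] : exists (i j : 'I_3) (m : nat),
  [/\ (m < 8)%N, (i < j)%N & (k : nat) = (3 + 8 * (i + j).-1 + m)%N].
  have k27 := ltn_ord k.
  have [h|h] := ltnP k 11.
    exists 0%:R, 1%:R, (k - 3)%N; split => //=; first by rewrite ltn_subLR.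
    by rewrite addn0 subnKC.
  have [h'|h'] := ltnP k 19.
    exists 0%:R, 2%:R, (k - 11)%N; split => //=; first by rewrite ltn_subLR.
    by rewrite subnKC.
  exists 1%:R, 2%:R, (k - 19)%N; split => //=; first by rewrite ltn_subLR.
  by rewrite subnKC.
by rewrite kK km; exact: u.
Qed.

Lemma albertD (x y : 'cV[R]_27) : albert (x + y) = albert x + albert y.
Proof.
apply/matrixP => i j; rewrite !mxE; case: eqP => _.
  by rewrite /oreal; repeat congr pair; rewrite /= ?addr0.
by case: ifP => _; rewrite /ocoord /oconj /cd_conj /= !mxE;
   repeat congr pair; rewrite /= ?opprD.
Qed.

Lemma albertZ (t : R) (x : 'cV[R]_27) i j :
  albert (t *: x) i j = t *: albert x i j.
Proof.
rewrite !mxE; case: eqP => _.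
  by rewrite /oreal; repeat congr pair; rewrite /= ?rscaleE ?mulr0.
by case: ifP => _; rewrite /ocoord /oconj /cd_conj /= !mxE;
   repeat congr pair; rewrite /= ?rscaleE ?mulrN.
Qed.

Lemma herm3D p q r a b c p' q' r' a' b' c' :
  herm3 p q r a b c + herm3 p' q' r' a' b' c' =
  herm3 (p + p') (q + q') (r + r') (a + a') (b + b') (c + c').
Proof.
odestruct a; odestruct b; odestruct c; odestruct a'; odestruct b'; odestruct c'.
apply/colP => -[k k27]; rewrite !mxE /=.
by do 27! [case: k k27 => [|k] k27 //=].
Qed.

Lemma herm3Z t p q r a b c : t *: herm3 p q r a b c =
  herm3 (t * p) (t * q) (t * r) (t *: a) (t *: b) (t *: c).
Proof.
odestruct a; odestruct b; odestruct c.
apply/colP => -[k k27]; rewrite !mxE /=.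
by do 27! [case: k k27 => [|k] k27 //=].
Qed.

(** In [jordan_mul] the scalar 2^-1 lives in the product ring R^8 acting
    coordinatewise on octonions; this form of the product uses the real scalar
    instead. *)
Lemma jordan_mulE (A B : 'M[octonion R]_3) i j : jordan_mul A B i j =
  (2^-1 : R) *: (\sum_k (omul (A i k) (B k j) + omul (B i k) (A k j))).
Proof.
rewrite big_split /=.
have -> : \sum_k omul (A i k) (B k j) + \sum_k omul (B i k) (A k j) =
          (omulmx A B + omulmx B A) i j by rewrite !mxE.
rewrite /jordan_mul; move: (omulmx A B + omulmx B A) => Z.
set h := _^-1; have h2 : h * 2 = 1.
  apply: mulVr; apply/unitrP.
  exists (((2^-1, 2^-1), (2^-1, 2^-1)), ((2^-1, 2^-1), (2^-1, 2^-1))).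
  by split; repeat congr pair; rewrite /= ?mulVf ?mulfV // pnatr_eq0.
have -> : h = (((2^-1, 2^-1), (2^-1, 2^-1)), ((2^-1, 2^-1), (2^-1, 2^-1))).
  move: h h2 => [[[a b] [c d]] [[e f] [g k]]] [] *.
  by repeat congr pair; apply: (@mulIf _ 2); rewrite ?mulVf // pnatr_eq0.
by rewrite mxE; move: (Z i j) => [[[a b] [c d]] [[e f] [g k]]].
Qed.
End Albert.

(** * Minors of elements of the exceptional cone *)

Lemma discriminant_le (R : realFieldType) (a b c : R) : 0 <= c ->
  (forall t, 0 <= a + t * b *+ 2 + t ^+ 2 * c) -> b ^+ 2 <= a * c.
Proof.
move=> c0 h; have [c1|c1] := eqVneq c 0.
  rewrite c1 mulr0; have [->|b0] := eqVneq b 0; first by rewrite expr0n.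
  have := h (- (a + 1) / b / 2); rewrite c1 mulr0 addr0.
  have -> : - (a + 1) / b / 2 * b *+ 2 = - (a + 1) by field.
  by lra.
have cp : 0 < c by rewrite lt_def c1.
have := h (- b / c).
have -> : a + - b / c * b *+ 2 + (- b / c) ^+ 2 * c = a - b ^+ 2 / c by field.
by rewrite subr_ge0 ler_pdivrMr.
Qed.

Lemma le_mean_of_sqr (R : realFieldType) (b p q : R) :
  0 <= p -> 0 <= q -> b ^+ 2 <= p * q -> b *+ 2 <= p + q.
Proof.
move=> p0 q0 h; rewrite leNgt; apply/negP => hb.
have : (p + q) ^+ 2 < (b *+ 2) ^+ 2 by rewrite ltr_pXn2r ?nnegrE //; lra.
by apply/negP; rewrite -leNgt; have := sqr_ge0 (p - q); nra.
Qed.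

Definition odot (R : realType) (x y : octonion R) : R :=
  let: (((a, b), (c, d)), ((e, f), (g, h))) := x in
  let: (((a', b'), (c', d')), ((e', f'), (g', h'))) := y in
  a * a' + b * b' + c * c' + d * d' + e * e' + f * f' + g * g' + h * h'.

Section Cone.
Context (R : realType).
Implicit Types x y z : octonion R.

Lemma onormD x y (t : R) :
  onorm (x + t *: y) = onorm x + t * odot x y *+ 2 + t ^+ 2 * onorm y.
Proof. odestruct x; odestruct y; rewrite /= ?rscaleE; ring. Qed.

Lemma odot_le x y p q : 0 <= p -> 0 <= q ->
  onorm x * onorm y <= p * q -> odot x y *+ 2 <= p + q.
Proof.
move=> p0 q0 h; apply: le_mean_of_sqr => //; apply: le_trans h.
apply: discriminant_le; first exact: onorm_ge0.
by move=> t; rewrite -onormD onorm_ge0.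
Qed.

(** Cauchy-Schwarz for sums of three octonion products: the norm is
    multiplicative, so each cross term is at most the geometric, hence the
    arithmetic, mean of the two corresponding terms on the right. *)
Lemma onorm_sum3 (p q : 'I_3 -> octonion R) :
  onorm (\sum_k omul (p k) (q k)) <=
  (\sum_k onorm (p k)) * (\sum_k onorm (q k)).
Proof.
rewrite !big_ord_recl !big_ord0 !addr0.
move: ord0 (lift _ _) (lift _ _) => i j k.
have D x y : onorm (x + y) = onorm x + odot x y *+ 2 + onorm y.
  by rewrite -[y in LHS]scale1r onormD mul1r expr1n mul1r.
have dD x y z : odot x (y + z) = odot x y + odot x z.
  odestruct x; odestruct y; odestruct z; rewrite /=; ring.
have dM u v : odot (omul (p u) (q u)) (omul (p v) (q v)) *+ 2 <=
   onorm (p u) * onorm (q v) + onorm (p v) * onorm (q u).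
  apply: odot_le; rewrite ?mulr_ge0 ?onorm_ge0 // !onormM.
  by rewrite mulrACA [X in _ <= X]mulrACA [onorm (q v) * _]mulrC.
rewrite !D dD !onormM; have := dM i j; have := dM i k; have := dM k j.
nra.
Qed.

Definition diag_entry (x : 'cV[R]_27) (i : 'I_3) : R := x (inord i) 0.

Lemma albert_diag (x : 'cV[R]_27) i : albert x i i = oreal (diag_entry x i).
Proof. by rewrite mxE eqxx. Qed.

Lemma albert_herm (x : 'cV[R]_27) i j : albert x j i = oconj (albert x i j).
Proof.
rewrite !mxE (eq_sym j); case: eqP => [->|/eqP ij]; first by oring.
rewrite (addnC i); have [//|ji|e] := ltngtP i j; first by rewrite oconjK.
by rewrite (ord_inj e) eqxx in ij.
Qed.

Lemma jordan_sqr (A : 'M[octonion R]_3) i j :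
  jordan_mul A A i j = \sum_k omul (A i k) (A k j).
Proof.
rewrite jordan_mulE big_split /=; move: (\sum_k _) => z; odestruct z.
by repeat congr pair; rewrite /= rscaleE; field.
Qed.

(** If x = y o y with y Hermitian, then x_ii is the sum of the |y_ik|^2. *)
Lemma cone_diag (x : 'cV[R]_27) i :
  exceptional_cone R x -> 0 <= diag_entry x i.
Proof.
move=> [y _ /matrixP/(_ i i)]; rewrite albert_diag jordan_sqr => e.
have : diag_entry x i = \sum_k onorm (albert y i k).
  move: e; under eq_bigr do rewrite (albert_herm y i) omul_conj.
  rewrite !big_ord_recl !big_ord0 => -[->]; by rewrite /= ?addr0.
by move=> ->; apply: sumr_ge0 => k _; exact: onorm_ge0.
Qed.

(** If x = y o y with y Hermitian, then x_ij is the sum of the y_ik (y_jk)*, so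
    that this is the Cauchy-Schwarz inequality for the rows i and j of y. *)
Lemma cone_minor (x : 'cV[R]_27) i j :
  exceptional_cone R x -> onorm (albert x i j) <= diag_entry x i * diag_entry x j.
Proof.
move=> [y _ /matrixP e].
have d k : diag_entry x k = \sum_l onorm (albert y k l).
  move: (e k k); rewrite albert_diag jordan_sqr.
  under eq_bigr do rewrite (albert_herm y k) omul_conj.
  by rewrite !big_ord_recl !big_ord0 => -[->]; rewrite /= ?addr0.
have c (z : octonion R) : onorm (oconj z) = onorm z.
  by odestruct z; rewrite /=; ring.
rewrite e jordan_sqr (le_trans (onorm_sum3 _ _)) // !d.
by under [in X in _ * X]eq_bigr do rewrite albert_herm c.
Qed.
End Cone.

(** * Self-adjoint operators and block decompositions *)

Section Bilinear.
Context (K : fieldType) (n : nat) (D : 'M[K]_n).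
Implicit Types (u v w : 'cV[K]_n) (a : K).

Local Notation f := (form D).

Lemma formDl u v w : f (u + v) w = f u w + f v w.
Proof. by rewrite /form linearD /= !mulmxDl mxE. Qed.

Lemma formDr u v w : f w (u + v) = f w u + f w v.
Proof. by rewrite /form mulmxDr mxE. Qed.

Lemma formZl a u v : f (a *: u) v = a * f u v.
Proof. by rewrite /form linearZ /= -!scalemxAl mxE. Qed.

Lemma formZr a u v : f u (a *: v) = a * f u v.
Proof. by rewrite /form -!scalemxAr mxE. Qed.

Lemma formNr u v : f u (- v) = - f u v.
Proof. by rewrite -scaleN1r formZr mulN1r. Qed.

Lemma formNl u v : f (- u) v = - f u v.
Proof. by rewrite -scaleN1r formZl mulN1r. Qed.

Lemma form0r u : f u 0 = 0.
Proof. by rewrite -(scale0r 0) formZr mul0r. Qed.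

Lemma form0l u : f 0 u = 0.
Proof. by rewrite -(scale0r 0) formZl mul0r. Qed.

Lemma form_swap u v : D^T = D -> f u v = f v u.
Proof.
move=> D_sym; rewrite /form -[LHS]trace_mx11 -mxtrace_tr trace_mx11.
by rewrite !trmx_mul trmxK D_sym mulmxA.
Qed.

End Bilinear.

Lemma pd_unit (R : realType) n (W : 'M[R]_n) :
  (forall u : 'cV[R]_n, u != 0 -> 0 < form W u u) -> W \in unitmx.
Proof.
move=> W_pos; apply/negPn/negP; rewrite unitmxE unitfE negbK => /det0P.
move=> [v v0 vW]; have := W_pos v^T.
rewrite -(inj_eq trmx_inj) trmxK linear0 v0 => /(_ isT).
by rewrite /form trmxK vW mul0mx mxE ltxx.
Qed.

Section Forms.
Context (R : realType) (n : nat) (D : 'M[R]_n).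
Hypothesis D_sym : D^T = D.
Hypothesis D_pos : forall u : 'cV[R]_n, u != 0 -> 0 < form D u u.
Implicit Types (u v w : 'cV[R]_n) (X M : 'M[R]_n).

Local Notation f := (form D).

Lemma form_ge0 u : 0 <= f u u.
Proof. by have [->|/D_pos/ltW//] := eqVneq u 0; rewrite form0r. Qed.

Lemma form_eq0 u : f u u = 0 -> u = 0.
Proof. by have [->//|/D_pos h e] := eqVneq u 0; rewrite e ltxx in h. Qed.

Definition self_adj X := forall u v, f (X *m u) v = f u (X *m v).
Definition psd X := forall u, 0 <= f u (X *m u).

Lemma mulmx_ext X M : (forall u, X *m u = M *m u) -> X = M.
Proof.
move=> h; apply/matrixP => i j.
have := h (delta_mx j 0); rewrite -!colE => /colP/(_ i); by rewrite !mxE.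
Qed.

Lemma psd_cauchy X u v : self_adj X -> psd X ->
  f u (X *m v) ^+ 2 <= f u (X *m u) * f v (X *m v).
Proof.
move=> sX pX; apply: discriminant_le; first exact: pX.
move=> t; have := pX (u + t *: v); rewrite mulmxDr -scalemxAr.
rewrite !formDl !formDr !formZl !formZr.
have -> : f v (X *m u) = f u (X *m v) by rewrite -sX (form_swap _ _ D_sym).
by move=> h; apply: le_trans h _; rewrite le_eqVlt; apply/orP; left; apply/eqP; ring.
Qed.

(** By [psd_cauchy], X u is orthogonal to every vector. *)
Lemma psd_ker X u : self_adj X -> psd X -> f u (X *m u) = 0 -> X *m u = 0.
Proof.
move=> sX pX e; apply: form_eq0; apply/eqP; rewrite -sqrf_eq0 sX.
rewrite eq_le sqr_ge0 andbT -[leRHS](mul0r (f (X *m u) (X *m (X *m u)))) -e.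
exact: psd_cauchy.
Qed.

Lemma self_adj_eq0 X : self_adj X -> (forall u, f u (X *m u) = 0) -> X = 0.
Proof.
move=> sX h; apply: mulmx_ext => u; rewrite mul0mx; apply: psd_ker => //.
by move=> v; rewrite h.
Qed.

Lemma form_proj P u : self_adj P -> P *m P = P ->
  f u (P *m u) = f (P *m u) (P *m u).
Proof. by move=> sP PP; rewrite sP mulmxA PP. Qed.

(** P, Q and T are the projections of an orthogonal decomposition.  The
    hypothesis [pM] is the positivity of all the operators r^2 P + q Q + r M;
    as a quadratic inequality in r it bounds M by its P-Q blocks. *)
Section Blocks.
Context (P Q T : 'M[R]_n).
Hypotheses (sP : self_adj P) (sQ : self_adj Q) (sT : self_adj T).
Hypotheses (PP : P *m P = P) (QQ : Q *m Q = Q) (TT : T *m T = T).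
Hypotheses (PQ : P *m Q = 0) (QP : Q *m P = 0).
Hypotheses (PT : P *m T = 0) (TP : T *m P = 0).
Hypotheses (QT : Q *m T = 0) (TQ : T *m Q = 0).
Hypothesis PQT : P + Q + T = 1%:M.
Context (M : 'M[R]_n) (q : R).
Hypothesis sM : self_adj M.

Hypothesis pM : forall (r : R) u,
  0 <= r ^+ 2 * f u (P *m u) + q * f u (Q *m u) + r * f u (M *m u).

Lemma block_disc u :
  f u (M *m u) ^+ 2 <= (q *+ 4) * f u (Q *m u) * f u (P *m u).
Proof.
have -> : f u (M *m u) ^+ 2 = (f u (M *m u) / 2) ^+ 2 *+ 4.
  by rewrite -mulr_natr; field.
rewrite !mulrnAl lerMn2r /=; apply: discriminant_le.
  by rewrite form_proj // form_ge0.
move=> t; have := pM t u.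
by move=> h; apply: le_trans h _; rewrite le_eqVlt; apply/orP; left; apply/eqP; field.
Qed.

(** By [block_disc], the quadratic form of M vanishes at the vectors killed by
    P and at those killed by Q. *)
Lemma block_zero X : self_adj X -> (forall u, P *m (X *m u) = 0) \/
  (forall u, Q *m (X *m u) = 0) -> X *m M *m X = 0.
Proof.
move=> sX h; apply: self_adj_eq0.
  by move=> u v; rewrite -!mulmxA sX sM sX.
move=> u; rewrite -!mulmxA -sX; apply/eqP; rewrite -sqrf_eq0 eq_le sqr_ge0 andbT.
apply: le_trans (block_disc _) _.
by case: h => ->; rewrite form0r !(mulr0, mul0r).
Qed.

(** Only the two blocks of M exchanging the images of P and Q survive. *)
Lemma block_struct : [/\ M *m P = Q *m M, M *m Q = P *m M,
  M *m T = 0 & T *m M = 0].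
Proof.
have sD A B : self_adj A -> self_adj B -> self_adj (A + B).
  by move=> sA sB u v; rewrite !mulmxDl formDl formDr sA sB.
have e1 : (Q + T) *m M *m (Q + T) = 0.
  apply: block_zero; first exact: sD.
  by left => u; rewrite mulmxA mulmxDr PQ PT addr0 mul0mx.
have e2 : (P + T) *m M *m (P + T) = 0.
  apply: block_zero; first exact: sD.
  by right => u; rewrite mulmxA mulmxDr QP QT addr0 mul0mx.
have key X Y A : A *m M *m A = 0 -> X *m A = X -> A *m Y = Y ->
    X *m M *m Y = 0.
  move=> e XA AY; rewrite -XA -AY.
  have -> : X *m A *m M *m (A *m Y) = X *m (A *m M *m A) *m Y.
    by rewrite !mulmxA.
  by rewrite e mulmx0 mul0mx.
have PMP : P *m M *m P = 0.
  by apply: key e2 _ _; rewrite ?mulmxDr ?mulmxDl PP ?PT ?TP addr0.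
have PMT : P *m M *m T = 0.
  by apply: key e2 _ _; rewrite ?mulmxDr ?mulmxDl ?PP ?PT ?TT ?(addr0, add0r).
have TMP : T *m M *m P = 0.
  by apply: key e2 _ _; rewrite ?mulmxDr ?mulmxDl ?PP ?TP ?TT ?(addr0, add0r).
have TMT : T *m M *m T = 0.
  by apply: key e2 _ _; rewrite ?mulmxDr ?mulmxDl ?PT ?TP ?TT ?(addr0, add0r).
have QMQ : Q *m M *m Q = 0.
  by apply: key e1 _ _; rewrite ?mulmxDr ?mulmxDl QQ ?QT ?TQ addr0.
have QMT : Q *m M *m T = 0.
  by apply: key e1 _ _; rewrite ?mulmxDr ?mulmxDl ?QQ ?QT ?TT ?(addr0, add0r).
have TMQ : T *m M *m Q = 0.
  by apply: key e1 _ _; rewrite ?mulmxDr ?mulmxDl ?QQ ?TQ ?TT ?(addr0, add0r).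
have L X : X = P *m X + Q *m X + T *m X by rewrite -!mulmxDl PQT mul1mx.
have Rr X : X = X *m P + X *m Q + X *m T by rewrite -!mulmxDr PQT mulmx1.
split.
- rewrite [LHS]L [RHS]Rr !mulmxA PMP TMP QMQ QMT !(addr0, add0r).
  by [].
- rewrite [LHS]L [RHS]Rr !mulmxA PMP PMT QMQ TMQ !(addr0, add0r).
  by [].
- by rewrite [LHS]L !mulmxA PMT QMT TMT !addr0.
- by rewrite [LHS]Rr TMP TMQ TMT !addr0.
Qed.

(** If y = M x with x in one of the images of P and Q, then y is in the other
    one, and [block_disc] at x + y reads 4 |y|^4 <= 4 q |x|^2 |y|^2. *)
Lemma block_norm u : 0 <= q ->
  f (M *m u) (M *m u) <= q * (f u (P *m u) + f u (Q *m u)).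
Proof.
move=> q0; have [MP MQ MT _] := block_struct.
have half x y : y = M *m x -> f x (M *m x) = 0 -> f y (M *m y) = 0 ->
    f (x + y) (Q *m (x + y)) * f (x + y) (P *m (x + y)) = f x x * f y y ->
    f y y <= q * f x x.
  move=> yE xx yy e; have := block_disc (x + y).
  rewrite -mulrA e mulmxDr !formDl !formDr xx yy add0r addr0 -yE.
  rewrite -sM -yE => h; have y0 := form_ge0 y.
  have x0 := form_ge0 x.
  have [->|y1] := eqVneq (f y y) 0; first exact: mulr_ge0.
  have yp : 0 < f y y by rewrite lt_def y1.
  by rewrite -(ler_pM2r yp); lra.
have oPQ a b : f (P *m a) (Q *m b) = 0 by rewrite sP mulmxA PQ mul0mx form0r.
have oQP a b : f (Q *m a) (P *m b) = 0 by rewrite sQ mulmxA QP mul0mx form0r.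
have MPv a : M *m (P *m a) = Q *m (M *m a) by rewrite !mulmxA MP.
have MQv a : M *m (Q *m a) = P *m (M *m a) by rewrite !mulmxA MQ.
have PPv a : P *m (P *m a) = P *m a by rewrite mulmxA PP.
have QQv a : Q *m (Q *m a) = Q *m a by rewrite mulmxA QQ.
have PQv a : P *m (Q *m a) = 0 by rewrite mulmxA PQ mul0mx.
have QPv a : Q *m (P *m a) = 0 by rewrite mulmxA QP mul0mx.
have hP : f (M *m (P *m u)) (M *m (P *m u)) <= q * f (P *m u) (P *m u).
  apply: half => //; rewrite ?(MPv, MQv) ?oPQ ?oQP //.
  rewrite !mulmxDr PPv QQv PQv QPv addr0 add0r.
  by rewrite !formDl oPQ oQP add0r addr0 mulrC.
have hQ : f (M *m (Q *m u)) (M *m (Q *m u)) <= q * f (Q *m u) (Q *m u).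
  apply: half => //; rewrite ?(MPv, MQv) ?oPQ ?oQP //.
  rewrite !mulmxDr PPv QQv PQv QPv addr0 add0r.
  by rewrite !formDl oPQ oQP add0r addr0.
have -> : M *m u = M *m (P *m u) + M *m (Q *m u).
  by rewrite -[in LHS](mul1mx u) -PQT !mulmxDl !mulmxDr (mulmxA M T) MT mul0mx addr0.
rewrite (form_proj _ sP PP) (form_proj _ sQ QQ) !formDl !formDr.
have -> : f (M *m (P *m u)) (M *m (Q *m u)) = 0 by rewrite MPv MQv oQP.
have -> : f (M *m (Q *m u)) (M *m (P *m u)) = 0 by rewrite MPv MQv oPQ.
by rewrite addr0 add0r mulrDr lerD.
Qed.

End Blocks.

Lemma block_form P Q T M u :
  self_adj Q -> self_adj M -> P *m P = P -> P + Q + T = 1%:M ->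
  M *m P = Q *m M -> M *m T = 0 ->
  f u (M *m u) = f (Q *m u) (M *m (P *m u)) *+ 2.
Proof.
move=> sQ sM PP PQT MP MT.
have uE : u = P *m u + Q *m u + T *m u by rewrite -!mulmxDl PQT mul1mx.
have -> : M *m u = M *m (P *m u) + M *m (Q *m u).
  by rewrite {1}uE !mulmxDr (mulmxA M T) MT mul0mx addr0.
rewrite formDr mulr2n; congr (_ + _).
  by rewrite sQ !mulmxA -MP -!mulmxA (mulmxA P P) PP.
by rewrite -sM (form_swap _ _ D_sym) !sQ !mulmxA -MP -(mulmxA M P P) PP.
Qed.

(** Completing the square: with p, s and t the components of u, the form is
    t |s + t^-1 M p|^2 + (1 - a/t) |p|^2 + (the square of the T-component). *)
Lemma block_pos P Q T M (a t : R) u :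
  self_adj P -> self_adj Q -> self_adj T -> self_adj M ->
  P *m P = P -> Q *m Q = Q -> T *m T = T -> P + Q + T = 1%:M ->
  M *m P = Q *m M -> M *m Q = P *m M -> M *m T = 0 ->
  M *m M *m P = a *: P -> 0 <= a -> a < t -> u != 0 ->
  0 < f u ((P + t *: Q + T + M) *m u).
Proof.
move=> sP sQ sT sM PP QQ TT PQT MP MQ MT MMP a0 ta.
have t0 : 0 < t by exact: le_lt_trans ta.
apply: contra_neqT; rewrite -leNgt.
have uE : u = P *m u + Q *m u + T *m u by rewrite -!mulmxDl PQT mul1mx.
have fM := block_form u sQ sM PP PQT MP MT.
set y := Q *m u + t^-1 *: (M *m (P *m u)).
have MM : f (M *m (P *m u)) (M *m (P *m u)) = a * f (P *m u) (P *m u).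
  by rewrite sM !mulmxA MMP -scalemxAl formZr.
have yE : t * f y y = t * f (Q *m u) (Q *m u) + f u (M *m u) +
    a / t * f (P *m u) (P *m u).
  rewrite fM /y !formDl !formDr !formZl !formZr MM.
  rewrite [f (M *m _) (Q *m u)](form_swap _ _ D_sym); field; exact: lt0r_neq0.
have p0 := form_ge0 (P *m u); have s0 := form_ge0 (T *m u).
have y0 := form_ge0 y.
have at1 : a / t < 1 by rewrite ltr_pdivrMr // mul1r.
rewrite !mulmxDl !formDr -!scalemxAl formZr.
rewrite (form_proj _ sP PP) (form_proj _ sQ QQ) (form_proj _ sT TT) => h.
have ty : 0 <= t * f y y by rewrite mulr_ge0 // ltW.
have {}h : (1 - a / t) * f (P *m u) (P *m u) + t * f y y +
   f (T *m u) (T *m u) <= 0 by lra.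
have ap : 0 <= (1 - a / t) * f (P *m u) (P *m u).
  by rewrite mulr_ge0 // subr_ge0 ltW.
have Pu : P *m u = 0.
  apply: (form_eq0); apply: (@mulfI _ (1 - a / t)); last by rewrite mulr0; lra.
  by rewrite subr_eq0 gt_eqF.
have Tu : T *m u = 0 by apply: (form_eq0); lra.
have Yu : y = 0.
  apply: (form_eq0); apply: (@mulfI _ t); last by rewrite mulr0; lra.
  exact: lt0r_neq0.
move: Yu; rewrite /y Pu mulmx0 scaler0 addr0 => Qu.
by rewrite uE Pu Qu Tu !addr0.
Qed.
End Forms.

(** * Rank one elements of the exceptional cone *)

Section RankOne.
Context (R : realType).
Implicit Types x y z : octonion R.

Definition herm_one : 'cV[R]_27 := herm3 1 1 1 0 0 0.

Lemma albert_one i j : albert herm_one i j = oreal (i == j)%:R.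
Proof.
rewrite albert_herm3; case: i => -[|[|[|//]]] hi; case: j => -[|[|[|//]]] hj //=;
  by rewrite /oconj /cd_conj; repeat congr pair; rewrite /= ?oppr0.
Qed.

Lemma omul_bilin (p q r s : R) x y z t :
  omul (p *: x + q *: y) (r *: z + s *: t) =
  (p * r) *: omul x z + (p * s) *: omul x t +
  ((q * r) *: omul y z + (q * s) *: omul y t).
Proof. odestruct x; odestruct y; odestruct z; odestruct t; oring. Qed.

Lemma omul1r x : omul (oreal 1) x = x.
Proof. by odestruct x; oring. Qed.

Lemma omulr1 x : omul x (oreal 1) = x.
Proof. by odestruct x; oring. Qed.

Lemma omul0r x : omul (oreal 0) x = 0.
Proof. by odestruct x; oring. Qed.

Lemma omulr0 x : omul x (oreal 0) = 0.
Proof. by odestruct x; oring. Qed.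

(** When x o x is a multiple of x, the span of x and 1 is an associative
    subalgebra: square roots and inverses are computed there, which avoids any
    spectral theory of the exceptional algebra. *)
Section QuasiIdempotent.
Context (x : 'cV[R]_27) (N : R).
Hypothesis x_sqr : forall i j,
  \sum_k omul (albert x i k) (albert x k j) = N *: albert x i j.

Lemma quasi_idem_mul (p q r s : R) :
  jordan_mul (albert (p *: x + q *: herm_one)) (albert (r *: x + s *: herm_one)) =
  albert ((p * r * N + p * s + q * r) *: x + (q * s) *: herm_one).
Proof.
have aE (t u : R) i j : albert (t *: x + u *: herm_one) i j =
    t *: albert x i j + u *: oreal (i == j)%:R.
  by rewrite albertD mxE !albertZ albert_one.
have mE (p' q' r' s' : R) i j :
  \sum_k omul (albert (p' *: x + q' *: herm_one) i k)
              (albert (r' *: x + s' *: herm_one) k j) =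
  (p' * r' * N + p' * s' + q' * r') *: albert x i j +
     (q' * s') *: oreal (i == j)%:R.
  under eq_bigr do rewrite !aE omul_bilin.
  rewrite !big_split /= -!scaler_sumr x_sqr.
  have -> : \sum_k omul (albert x i k) (oreal (k == j)%:R) = albert x i j.
    rewrite (bigD1 j) //= eqxx omulr1 big1 ?addr0 // => k /negPf ->.
    exact: omulr0.
  have -> : \sum_k omul (oreal (i == k)%:R) (albert x k j) = albert x i j.
    rewrite (bigD1 i) //= eqxx omul1r big1 ?addr0 // => k.
    rewrite eq_sym => /negPf ->; exact: omul0r.
  have -> : \sum_k omul (oreal (i == k)%:R) (oreal (k == j)%:R) =
            oreal (i == j)%:R :> octonion R.
    rewrite (bigD1 i) //= eqxx omul1r big1 ?addr0 // => k.
    rewrite eq_sym => /negPf ->; exact: omul0r.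
  by rewrite scalerA !scalerDl addrA.
apply/matrixP => i j; rewrite jordan_mulE big_split /= !mE aE.
move: (albert x i j) (oreal _) => y z; odestruct y; odestruct z.
by repeat congr pair; rewrite /= !rscaleE; field.
Qed.

(** The element x + e is the square of a x + b with b^2 = e and
    a^2 N + 2 a b = 1; since N >= 0, the quadratic equation for a has the
    positive root 1 / (b + sqrt (e + N)). *)
Lemma quasi_idem_cone (e : R) : 0 <= N -> 0 < e ->
  exceptional_cone R (x + e *: herm_one).
Proof.
move=> N0 e0; pose b := Num.sqrt e; pose c := Num.sqrt (e + N).
have b0 : 0 < b by rewrite sqrtr_gt0.
have bb : b ^+ 2 = e by rewrite sqr_sqrtr // ltW.
have c0 : 0 <= c := sqrtr_ge0 _.
have cc : c ^+ 2 = e + N by rewrite sqr_sqrtr // addr_ge0 // ltW.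
pose a := (b + c)^-1.
have bc0 : b + c != 0 by rewrite gt_eqF // ltr_wpDr.
have a0 : 0 < a by rewrite invr_gt0 ltr_wpDr.
have NE : N = c ^+ 2 - b ^+ 2 by rewrite cc bb addrC addKr.
have aN : a * a * N + a * b + b * a = 1.
  by rewrite NE /a; field.
have d0 : a * N + b != 0 by rewrite gt_eqF // ltr_wpDl // mulr_ge0 // ltW.
have b0' : b != 0 by rewrite gt_eqF.
have sq := quasi_idem_mul a b a b.
exists (a *: x + b *: herm_one); last by rewrite sq aN scale1r -expr2 bb.
exists ((- a / (b * (a * N + b))) *: x + b^-1 *: herm_one); split; last first.
  rewrite sq quasi_idem_mul; congr (albert (_ *: _ + _ *: _)).
    by field; rewrite d0 b0'.
  by field.
rewrite quasi_idem_mul; apply/matrixP => i j; rewrite albertD mxE !albertZ.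
rewrite albert_one [jordan_one R i j]mxE mulfV // scale1r.
have -> : a * (- a / (b * (a * N + b))) * N + a * b^-1 +
   b * (- a / (b * (a * N + b))) = 0.
  by field; rewrite d0 b0'.
by rewrite scale0r add0r.
Qed.
End QuasiIdempotent.

(** The matrix v v* for the vector v = (p, a, b). *)
Definition rank1_herm (p : R) (a b : octonion R) : 'cV[R]_27 :=
  herm3 (p ^+ 2) (onorm a) (onorm b)
    (p *: oconj a) (p *: oconj b) (omul a (oconj b)).

Lemma oconjM x y : oconj (omul x y) = omul (oconj y) (oconj x).
Proof. odestruct x; odestruct y; oring. Qed.

Lemma oconjZ (r : R) x : oconj (r *: x) = r *: oconj x.
Proof.
odestruct x; rewrite /oconj /cd_conj /=.
by repeat congr pair; rewrite /= ?rscaleE; ring.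
Qed.

(** This identity and the next one express alternativity; they are all the
    associativity that rank one elements need. *)
Lemma omulKl x y : omul (oconj x) (omul x y) = onorm x *: y.
Proof. odestruct x; odestruct y; rewrite /onorm; oring. Qed.

Lemma omulKr x y : omul (omul y (oconj x)) x = onorm x *: y.
Proof. odestruct x; odestruct y; rewrite /onorm; oring. Qed.

Lemma omulZr (r : R) x y : omul x (r *: y) = r *: omul x y.
Proof. odestruct x; odestruct y; oring. Qed.

Lemma omul_reall (r : R) x : omul (oreal r) x = r *: x.
Proof. odestruct x; oring. Qed.

Lemma omul_realr (r : R) x : omul x (oreal r) = r *: x.
Proof. odestruct x; oring. Qed.

Lemma onorm_conj x : onorm (oconj x) = onorm x.
Proof. odestruct x; rewrite /=; ring. Qed.

Lemma oconj_mul x : omul (oconj x) x = oreal (onorm x).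
Proof. by rewrite -{2}(oconjK x) omul_conj onorm_conj. Qed.

(** (v v* )(v v* ) = |v|^2 v v* : as p is real, every triple product that occurs
    involves only two octonions, and alternativity suffices. *)
Lemma rank1_sqr p a b i j :
  \sum_k omul (albert (rank1_herm p a b) i k) (albert (rank1_herm p a b) k j) =
  (p ^+ 2 + onorm a + onorm b) *: albert (rank1_herm p a b) i j.
Proof.
have N3 : omul (omul a (oconj b)) (omul b (oconj a)) =
    oreal (onorm a * onorm b).
  by rewrite -[X in omul _ X]oconjK oconjM oconjK omul_conj onormM onorm_conj.
have N3' : omul (omul b (oconj a)) (omul a (oconj b)) =
    oreal (onorm a * onorm b).
  rewrite -[X in omul _ X]oconjK oconjM oconjK omul_conj onormM onorm_conj.
  by rewrite mulrC.
rewrite !big_ord_recl big_ord0 !albert_herm3.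
case: i => -[|[|[|//]]] hi; case: j => -[|[|[|//]]] hj /=;
rewrite !(oconjM, oconjZ, oconjK, omulZl, omulZr, omul_conj, oconj_mul,
  omul_reall, omul_realr, omulKl, omulKr, onorm_conj, onormM, N3, N3').
all: generalize (onorm a) (onorm b) (omul a (oconj b)) (omul b (oconj a))
  (oconj a) (oconj b) => na nb x y z t.
all: repeat match goal with x : _ |- _ => match type of x with 
  GRing.Lmodule.sort (octonion R) => odestruct x end end.
all: rewrite /oreal; repeat congr pair; rewrite /= ?rscaleE; ring.
Qed.

Lemma rank1_cone p a b (e : R) : 0 < e ->
  exceptional_cone R (rank1_herm p a b + e *: herm_one).
Proof.
apply: (quasi_idem_cone (rank1_sqr p a b)).
by rewrite !addr_ge0 ?sqr_ge0 ?onorm_ge0.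
Qed.
End RankOne.

(** * A basis adapted to the diagonal idempotents *)

Section AlbertBasis.
Context (R : realType).
Implicit Types (a b c : octonion R) (w : 'cV[R]_27).

Definition ix0 : 'I_3 := @Ordinal 3 0 isT.
Definition ix1 : 'I_3 := @Ordinal 3 1 isT.
Definition ix2 : 'I_3 := @Ordinal 3 2 isT.

Lemma ord3P (i : 'I_3) : [\/ i = ix0, i = ix1 | i = ix2].
Proof.
case: i => -[|[|[|//]]] hi; [apply: Or31|apply: Or32|apply: Or33];
  exact: val_inj.
Qed.

Lemma diag_entry_herm3 (p q r : R) a b c i :
  diag_entry (herm3 p q r a b c) i = [:: p; q; r]`_i.
Proof.
have := albert_herm3 p q r a b c i i; rewrite albert_diag.
by case: (ord3P i) => -> /= -[].
Qed.

Lemma herm3_eta w : w =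
  herm3 (diag_entry w ix0) (diag_entry w ix1) (diag_entry w ix2)
    (albert w ix0 ix1) (albert w ix0 ix2) (albert w ix1 ix2).
Proof.
apply: albert_inj; apply/matrixP => i j; rewrite albert_herm3.
by case: (ord3P i) => ->; case: (ord3P j) => -> /=;
   rewrite -?albert_herm ?albert_diag.
Qed.

Definition diag_idem (i : 'I_3) : 'cV[R]_27 :=
  herm3 (i == ix0)%:R (i == ix1)%:R (i == ix2)%:R 0 0 0.
Definition off01 a : 'cV[R]_27 := herm3 0 0 0 a 0 0.
Definition off02 a : 'cV[R]_27 := herm3 0 0 0 0 a 0.
Definition off12 a : 'cV[R]_27 := herm3 0 0 0 0 0 a.

Lemma diag_entry_idem i j : diag_entry (diag_idem i) j = (i == j)%:R.
Proof. by rewrite diag_entry_herm3; case: (ord3P j) => ->. Qed.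

Lemma herm3E (p q r : R) a b c : herm3 p q r a b c =
  p *: diag_idem ix0 + q *: diag_idem ix1 + r *: diag_idem ix2 +
  off01 a + off02 b + off12 c.
Proof.
by rewrite !herm3Z !herm3D /= !(scaler0, mulr1, mulr0, addr0, add0r).
Qed.

Lemma herm3_0 : herm3 0 0 0 0 0 0 = 0 :> 'cV[R]_27.
Proof. by rewrite -[RHS](scale0r (herm3 0 0 0 0 0 0)) herm3Z !(mul0r, scale0r). Qed.

Lemma off01_0 : off01 0 = 0. Proof. exact: herm3_0. Qed.
Lemma off02_0 : off02 0 = 0. Proof. exact: herm3_0. Qed.
Lemma off12_0 : off12 0 = 0. Proof. exact: herm3_0. Qed.

Lemma off12B a b : off12 (a - b) = off12 a - off12 b.
Proof.
by rewrite -[- off12 b]scaleN1r herm3Z herm3D !(mulr0, scaler0, addr0) scaleN1r.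
Qed.

Lemma off01Z (r : R) a : off01 (r *: a) = r *: off01 a.
Proof. by rewrite herm3Z !(mulr0, scaler0). Qed.
Lemma off02Z (r : R) a : off02 (r *: a) = r *: off02 a.
Proof. by rewrite herm3Z !(mulr0, scaler0). Qed.
Lemma off12Z (r : R) a : off12 (r *: a) = r *: off12 a.
Proof. by rewrite herm3Z !(mulr0, scaler0). Qed.

Lemma herm_one_sum : herm_one R = diag_idem ix0 + diag_idem ix1 + diag_idem ix2.
Proof. by rewrite /herm_one herm3E !scale1r off01_0 off02_0 off12_0 !addr0. Qed.

Lemma diag_entry_one i : diag_entry (herm_one R) i = 1.
Proof. by rewrite diag_entry_herm3; case: (ord3P i) => ->. Qed.

Lemma diag_entryD v w i : diag_entry (v + w) i = diag_entry v i + diag_entry w i.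
Proof. by rewrite /diag_entry mxE. Qed.

Lemma diag_entryZ (r : R) w i : diag_entry (r *: w) i = r * diag_entry w i.
Proof. by rewrite /diag_entry mxE. Qed.

(** The form in which the extremality of the diagonal idempotents is used. *)
Lemma diag_idem_multiple w i :
  (forall j k, j != i -> albert w j k = 0) -> w = diag_entry w i *: diag_idem i.
Proof.
move=> h; have d j : j != i -> diag_entry w j = 0.
  by move=> /(h j j); rewrite albert_diag => -[].
have h' j k : k != i -> albert w j k = 0.
  move=> ki; rewrite (albert_herm w k j) h //.
  by rewrite /oconj /cd_conj /=; repeat congr pair; rewrite /= ?oppr0.
rewrite [LHS]herm3_eta /diag_idem herm3Z /= !scaler0.
case: (ord3P i) d h h' => -> d h h'; rewrite /= !mulr0 mulr1.
- by rewrite (d ix1) // (d ix2) // (h' ix0 ix1) // (h' ix0 ix2) // (h ix1 ix2).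
- by rewrite (d ix0) // (d ix2) // (h ix0 ix1) // (h ix0 ix2) // (h' ix1 ix2).
- by rewrite (d ix0) // (d ix1) // (h ix0 ix1) // (h ix0 ix2) // (h ix1 ix2).
Qed.
Lemma herm_one_cone : exceptional_cone R (herm_one R).
Proof.
have := @rank1_cone R 0 0 0 1 ltr01; rewrite scale1r.
suff -> : rank1_herm (0 : R) 0 0 = 0 by rewrite add0r.
rewrite /rank1_herm !scale0r expr0n /= -[RHS]herm3_0; congr herm3.
- by rewrite /=; ring.
- by rewrite /=; ring.
- by rewrite -[X in omul X _](scale0r 0) omulZl scale0r.
Qed.

End AlbertBasis.

(** * The exceptional algebra has no faithful operator representation *)

(** S is a linear map to symmetric matrices that recognizes the exceptional
    cone as the inverse image of the positive definite ones.  The closure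
    hypothesis [S_sq] has the inverse of S(1) in it, so that S(1) need not be
    normalized to the identity. *)
Section Special.
Context (R : realType) (n : nat) (S : {linear 'cV[R]_27 -> 'M[R]_n}).
Hypothesis S_sym : forall x, (S x)^T = S x.
Hypothesis S_inj : forall x, S x = 0 -> x = 0.
Hypothesis S_cone : forall x, exceptional_cone R x <->
  (forall u : 'cV[R]_n, u != 0 -> 0 < form (S x) u u).
Hypothesis S_sq : forall x, exists w,
  S x *m invmx (S (herm_one R)) *m S x = S w.
Implicit Types (u v : 'cV[R]_n) (x w : 'cV[R]_27).

Let D := S (herm_one R).
Definition special_op x : 'M[R]_n := invmx D *m S x.
Local Notation M := special_op.
Local Notation f := (form D).

Let D_sym : D^T = D. Proof. exact: S_sym. Qed.

Let D_pos u : u != 0 -> 0 < f u u.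
Proof. by have [+ _] := S_cone (herm_one R); move=> /(_ (herm_one_cone R)); apply. Qed.

Let D_unit : D \in unitmx. Proof. exact: pd_unit D_pos. Qed.

Lemma form_special_op x u v : f u (M x *m v) = form (S x) u v.
Proof. by rewrite /form /M !mulmxA -[u^T *m _ *m _]mulmxA mulmxV // mulmx1. Qed.

Lemma special_op_sa x : self_adj D (M x).
Proof.
move=> u v; rewrite (form_swap _ _ D_sym) !form_special_op.
by rewrite (form_swap _ _ (S_sym x)).
Qed.

Lemma special_opD x w : M (x + w) = M x + M w.
Proof. by rewrite /M linearD mulmxDr. Qed.

Lemma special_opZ a x : M (a *: x) = a *: M x.
Proof. by rewrite /M linearZ -scalemxAr. Qed.

Lemma special_opB x w : M (x - w) = M x - M w.
Proof. by rewrite special_opD -scaleN1r special_opZ scaleN1r. Qed.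

Lemma special_op1 : M (herm_one R) = 1%:M. Proof. exact: mulVmx. Qed.

Lemma special_op_inj x : M x = 0 -> x = 0.
Proof.
move=> h; apply: S_inj; have := congr1 (mulmx D) h.
by rewrite /M mulmxA mulmxV // mul1mx mulmx0.
Qed.

Lemma special_op_sq x : exists w, M x *m M x = M w.
Proof. by have [w e] := S_sq x; exists w; rewrite /M -e !mulmxA. Qed.

Lemma special_op_cone x : exceptional_cone R x <->
  (forall u, u != 0 -> 0 < f u (M x *m u)).
Proof.
by rewrite S_cone; split => h u /h; rewrite form_special_op.
Qed.

Lemma psd_special_op x : (forall e, 0 < e -> exceptional_cone R (x + e *: herm_one R)) ->
  psd D (M x).
Proof.
move=> h u; have [->|u0] := eqVneq u 0; first by rewrite mulmx0 form0r.
rewrite leNgt; apply/negP => neg.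
have fu := D_pos u0.
have e0 : 0 < - f u (M x *m u) / f u u by rewrite divr_gt0 // oppr_gt0.
have /special_op_cone/(_ u u0) := h _ e0.
rewrite special_opD special_opZ special_op1 mulmxDl -scalemxAl mul1mx formDr formZr.
by rewrite divfK ?gt_eqF // addrN ltxx.
Qed.

Lemma cone_of_psd w e : psd D (M w) -> 0 < e ->
  exceptional_cone R (w + e *: herm_one R).
Proof.
move=> pw e0; apply/special_op_cone => u u0.
rewrite special_opD special_opZ special_op1 mulmxDl -scalemxAl mul1mx formDr formZr.
by rewrite ltr_wpDl // mulr_gt0 // D_pos.
Qed.

(** A positive semidefinite M(w) means that w + e is in the cone for all e > 0;
    the inequalities of the cone pass to the limit, here and in
    [psd_minor]. *)
Lemma psd_diag_entry w i : psd D (M w) -> 0 <= diag_entry w i.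
Proof.
move=> pw; apply/ler_addgt0Pr => e e0.
have := cone_diag i (cone_of_psd pw e0).
by rewrite diag_entryD diag_entryZ diag_entry_one mulr1.
Qed.

Lemma psd_minor w i j : psd D (M w) ->
  onorm (albert w i j) <= diag_entry w i * diag_entry w j.
Proof.
move=> pw; have a0 := psd_diag_entry i pw; have b0 := psd_diag_entry j pw.
have [->|ij] := eqVneq i j.
  rewrite albert_diag /= !expr0n /= !addr0 expr2; exact: lexx.
apply/ler_addgt0Pr => d d0; set a := diag_entry w i in a0 *.
set b := diag_entry w j in b0 *.
pose e := d / (a + b + 1 + d).
have q0 : 0 < a + b + 1 + d by lra.
have e0 : 0 < e by rewrite divr_gt0.
have e1 : e < 1 by rewrite ltr_pdivrMr // mul1r; lra.
have := cone_minor i j (cone_of_psd pw e0).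
rewrite !diag_entryD !diag_entryZ !diag_entry_one
  albertD mxE albertZ albert_one (negPf ij).
have -> : e *: oreal (false%:R) = 0 :> octonion R.
  by rewrite /oreal; repeat congr pair; rewrite /= rscaleE mulr0.
rewrite addr0 !mulr1 => h; apply: le_trans h _.
have ed : e * (a + b + 1 + d) = d by rewrite divfK // gt_eqF.
rewrite -/a -/b; have : e * e <= e by rewrite ger_pMr // ltW.
have : 0 <= e * d by rewrite mulr_ge0 ?ltW.
nra.
Qed.

Lemma psd_row0 w i j : psd D (M w) -> diag_entry w i = 0 -> albert w i j = 0.
Proof.
move=> pw wi; have := psd_minor i j pw; rewrite wi mul0r.
move: (albert w i j) => [[[a b] [c d]] [[e g] [h k]]] /= le0.
have sq (x : R) : 0 <= x ^+ 2 := sqr_ge0 x.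
have z (x : R) : x ^+ 2 <= 0 -> x = 0.
  by move=> h0; apply/eqP; rewrite -sqrf_eq0 eq_le h0 sq.
have := (sq a, sq b, (sq c, sq d), (sq e, sq g, (sq h, sq k))).
move=> -[[[sa sb] [sc sd]] [[se sg] [sh sk]]].
by repeat congr pair; apply: z; lra.
Qed.

Lemma psd_rank1 p a b : psd D (M (rank1_herm p a b)).
Proof. by apply: psd_special_op => e; exact: rank1_cone. Qed.

Lemma onorm0 : onorm (0 : octonion R) = 0.
Proof. by rewrite /=; ring. Qed.

Lemma oconj0 : oconj (0 : octonion R) = 0.
Proof. by have := oconjZ 0 (0 : octonion R); rewrite !scale0r. Qed.

Lemma omul0l (a : octonion R) : omul 0 a = 0.
Proof. by have := omulZl 0 0 a; rewrite !scale0r. Qed.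

Lemma omul0 (a : octonion R) : omul a 0 = 0.
Proof. by have := omulZr 0 a 0; rewrite !scale0r. Qed.

Lemma rank1_01 p a : rank1_herm p a 0 =
  p ^+ 2 *: diag_idem R ix0 + onorm a *: diag_idem R ix1 + p *: off01 (oconj a).
Proof.
rewrite /rank1_herm herm3E onorm0 oconj0 omul0 !scaler0 off02_0 off12_0 scale0r !addr0.
by rewrite off01Z.
Qed.

Lemma rank1_02 p b : rank1_herm p 0 b =
  p ^+ 2 *: diag_idem R ix0 + onorm b *: diag_idem R ix2 + p *: off02 (oconj b).
Proof.
rewrite /rank1_herm herm3E onorm0 oconj0 omul0l !scaler0 off01_0 off12_0 scale0r !addr0.
by rewrite off02Z.
Qed.

(** The free real parameter is now the last coordinate of v, so that the last
    index plays the part that the first one has in [rank1_01] and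
    [rank1_02]. *)
Lemma rank1_12 (p : R) b : rank1_herm 0 b (oreal p) =
  p ^+ 2 *: diag_idem R ix2 + onorm b *: diag_idem R ix1 + p *: off12 b.
Proof.
have -> : rank1_herm 0 b (oreal p) = herm3 0 (onorm b) (p ^+ 2) 0 0 (p *: b).
  rewrite /rank1_herm !scale0r expr0n /=; congr herm3; first by rewrite /=; ring.
  rewrite -[RHS]omul_realr; congr omul.
  by rewrite /oconj /oreal /cd_conj /=; repeat congr pair; rewrite /= oppr0.
rewrite herm3E off01_0 off02_0 scale0r add0r !addr0 off12Z; congr (_ + _).
by rewrite addrC.
Qed.

Local Notation P i := (M (diag_idem R i)).

Lemma psd_idem i : psd D (P i).
Proof.
have -> : diag_idem R i = match val i with 0 => rank1_herm 1 0 0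
    | 1 => rank1_herm 0 (oreal 1) 0 | _ => rank1_herm 0 0 (oreal 1) end.
  have n1 : onorm (oreal (1 : R)) = 1 by rewrite /=; ring.
  case: (ord3P i) => -> /=.
  - by rewrite rank1_01 onorm0 oconj0 off01_0 !(scaler0, scale0r) expr1n scale1r !addr0.
  - by rewrite rank1_01 n1 expr0n !scale0r scale1r addr0 add0r.
  - by rewrite rank1_02 n1 expr0n !scale0r scale1r addr0 add0r.
by case: (val i) => [|[|?]]; exact: psd_rank1.
Qed.

Lemma idem_sum : P ix0 + P ix1 + P ix2 = 1%:M.
Proof. by rewrite -!special_opD -herm_one_sum special_op1. Qed.

Lemma idem_le1 i j u : i != j -> f u (P i *m u) + f u (P j *m u) <= f u u.
Proof.
have := congr1 (fun X => f u (X *m u)) idem_sum.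
rewrite /= mul1mx !mulmxDl !formDr => <-.
have := psd_idem ix0 u; have := psd_idem ix1 u; have := psd_idem ix2 u.
by case: (ord3P i) => ->; case: (ord3P j) => -> //=; lra.
Qed.

(** Write P for the operator and e for the idempotent.  Since 0 <= P <= 1, the
    square of P is between 0 and P, so it comes from an element between 0 and e,
    which is a multiple l e by the inequalities on minors: P^2 = l P with
    0 <= l <= 1.  If l < 1, then 1 - (2 - l) P is positive definite, because its
    form at u is |u - P u|^2; but 1 - (2 - l) e has the negative diagonal entry
    l - 1. *)
Lemma idem_sq i : P i *m P i = P i.
Proof.
have le1 u : f u (P i *m u) <= f u u.
  have [j ij] : exists j, i != j.
    by case: (ord3P i) => ->; [exists ix1|exists ix0|exists ix0].
  by have := idem_le1 u ij; have := psd_idem j u; lra.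
have sqE u : f u (P i *m P i *m u) = f (P i *m u) (P i *m u).
  by rewrite -mulmxA -special_op_sa.
have sq_le u : f (P i *m u) (P i *m u) <= f u (P i *m u).
  have h := psd_cauchy D_sym u (P i *m u) (special_op_sa _) (psd_idem i).
  have e : f u (P i *m (P i *m u)) = f (P i *m u) (P i *m u).
    by rewrite -special_op_sa.
  rewrite e in h.
  have y0 : 0 <= f (P i *m u) (P i *m u) by exact: form_ge0 D_pos _.
  have p0 := psd_idem i u.
  have [->//|y1] := eqVneq (f (P i *m u) (P i *m u)) 0.
  have yp : 0 < f (P i *m u) (P i *m u) by rewrite lt_def y1.
  rewrite -(ler_pM2r yp) -expr2; apply: le_trans h _.
  by rewrite ler_wpM2l // le1.
have [w wE] := special_op_sq (diag_idem R i).
have pw : psd D (M w) by move=> u; rewrite -wE sqE form_ge0.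
have pw' : psd D (M (diag_idem R i - w)).
  move=> u; rewrite special_opB mulmxBl -wE formDr formNr sqE subr_ge0; exact: sq_le.
have wl := psd_diag_entry _ pw.
have wu j : diag_entry w j <= (i == j)%:R.
  have := psd_diag_entry j pw'.
  by rewrite diag_entryD diag_entry_idem -scaleN1r diag_entryZ mulN1r subr_ge0.
have w0 j : j != i -> diag_entry w j = 0.
  move=> ji; apply/eqP; rewrite eq_le wl andbT; have := wu j.
  by rewrite eq_sym (negPf ji).
have wi : w = diag_entry w i *: diag_idem R i.
  by apply: diag_idem_multiple => j k ji; apply: psd_row0 => //; exact: w0.
set l := diag_entry w i in wi.
have l0 : 0 <= l := wl i.
have l1 : l <= 1 by have := wu i; rewrite eqxx.
rewrite wi special_opZ in wE.
suff l_eq : l = 1 by rewrite wE l_eq scale1r.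
apply/eqP; rewrite eq_le l1 /= leNgt; apply/negP => ll.
have : exceptional_cone R (herm_one R - (2 - l) *: diag_idem R i).
  apply/special_op_cone => u u0.
  have -> : f u (M (herm_one R - (2 - l) *: diag_idem R i) *m u) =
      f (u - P i *m u) (u - P i *m u).
    rewrite special_opB special_op1 special_opZ mulmxBl mul1mx -scalemxAl.
    rewrite !formDl !formDr !formNl !formNr formZr -sqE wE -scalemxAl formZr.
    rewrite (form_swap (P i *m u) _ D_sym); ring.
  apply: D_pos; apply: contra_neq u0 => /eqP; rewrite subr_eq0 => /eqP uP.
  have : P i *m u = l *: (P i *m u).
    by rewrite {1}uP mulmxA wE scalemxAl.
  move=> /eqP; rewrite -subr_eq0 -{1}(scale1r (P i *m u)) -scalerBl scaler_eq0.
  by rewrite subr_eq0 gt_eqF //= => /eqP Pu0; rewrite uP Pu0.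
move=> /(@cone_diag _ _ i); rewrite diag_entryD -scaleN1r !diag_entryZ diag_entry_one.
rewrite diag_entry_idem eqxx /=; lra.
Qed.

(** On the image of P_j, the inequality P_i + P_j <= 1 leaves no room
    for P_i. *)
Lemma idem_orth i j : i != j -> P i *m P j = 0.
Proof.
move=> ij; apply: mulmx_ext => u; rewrite mul0mx -mulmxA.
apply: (psd_ker D_sym D_pos) (special_op_sa _) (psd_idem i) _.
apply/eqP; rewrite eq_le psd_idem andbT.
by have := idem_le1 (P j *m u) ij; rewrite [P j *m (_ *m _)]mulmxA idem_sq; lra.
Qed.

Lemma idem_sum3 i j k : i != j -> i != k -> j != k -> P i + P j + P k = 1%:M.
Proof.
rewrite -idem_sum; case: (ord3P i) => ->; case: (ord3P j) => -> //;
case: (ord3P k) => -> // _ _ _; move: (P ix0) (P ix1) (P ix2) => X Y Z.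
- by rewrite addrAC.
- by rewrite (addrC Y).
- by rewrite addrC addrA.
- by rewrite -addrA addrC.
- by rewrite addrC (addrC Z) addrA.
Qed.

(** The positivity hypothesis of [block_struct] for the projections attached to
    the indices i and j. *)
Definition peirce_psd i j (q : R) x := forall r : R,
  psd D (M (r ^+ 2 *: diag_idem R i + q *: diag_idem R j + r *: x)).

Lemma offdiag_struct i j k q x : i != j -> i != k -> j != k ->
  peirce_psd i j q x ->
  [/\ M x *m P i = P j *m M x, M x *m P j = P i *m M x,
      M x *m P k = 0 & P k *m M x = 0].
Proof.
move=> ij ik jk px.
apply: (@block_struct _ _ D D_sym D_pos (P i) (P j) (P k) _ _ _ _ _ _ _ _ _ _
  _ _ _ (M x) q); rewrite ?idem_sq ?idem_orth // 1?eq_sym //; try exact: special_op_sa.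
  exact: idem_sum3.
move=> r u; have := px r u.
by rewrite !special_opD !special_opZ !mulmxDl !formDr -!scalemxAl !formZr.
Qed.

(** What the proof of [offdiag_sq] uses of the family of elements whose only
    nonzero entry above the diagonal is at the place (i,j). *)
Definition peirce_family i j k (F : octonion R -> 'cV[R]_27) :=
  [/\ forall a l, diag_entry (F a) l = 0,
      forall a, onorm (albert (F a) i j) = onorm a,
      forall a, peirce_psd i j (onorm a) (F a) &
      forall w, (forall l, albert w k l = 0) ->
        exists z, w = diag_entry w i *: diag_idem R i +
          diag_entry w j *: diag_idem R j + F z].

Lemma albert_diag_idem_offdiag l i j : i != j -> albert (diag_idem R l) i j = 0.
Proof.
rewrite albert_herm3; case: (ord3P i) => ->; case: (ord3P j) => -> //= _;
  exact: oconj0.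
Qed.

Lemma albertDE x w i j : albert (x + w) i j = albert x i j + albert w i j.
Proof. by rewrite albertD mxE. Qed.

(** The square of M(F a) is M(w) for some w.  Its positivity and [block_norm]
    put w between 0 and |a|^2 (e_i + e_j), so that w has no entry outside the
    places i and j; its off-diagonal part has to vanish because the square
    preserves the images of P_i and P_j.  Thus the square is al P_i + be P_j with
    al, be <= |a|^2.  The converse inequalities come from the minors of the cone:
    if al < t < |a|^2, then e_i + t e_j + e_k + F a is in the cone by
    [block_pos], although its minor t - |a|^2 is negative. *)
Lemma offdiag_sq i j k F a : i != j -> i != k -> j != k ->
  peirce_family i j k F ->
  M (F a) *m M (F a) = onorm a *: (P i + P j).
Proof.
move=> ij ik jk [F0 FN Fp Fw]; have q0 := onorm_ge0 a.
have ji : j != i by rewrite eq_sym.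
have [MPi MPj MPk PkM] := offdiag_struct ij ik jk (Fp a).
have [w wE] := special_op_sq (F a).
have sqE u : f u (M (F a) *m M (F a) *m u) = f (M (F a) *m u) (M (F a) *m u).
  by rewrite -mulmxA -special_op_sa.
have pw : psd D (M w) by move=> u; rewrite -wE sqE form_ge0.
have pw' : psd D (M (onorm a *: (diag_idem R i + diag_idem R j) - w)).
  move=> u; rewrite special_opB mulmxBl -wE formDr formNr sqE subr_ge0.
  rewrite special_opZ special_opD -scalemxAl mulmxDl formZr formDr.
  apply: (@block_norm _ _ D D_sym D_pos (P i) (P j) (P k) _ _ _ _ _ _ _ _ _ _
    _ _ _ (M (F a)) (onorm a)); rewrite ?idem_sq ?idem_orth // 1?eq_sym //;
    try exact: special_op_sa.
    exact: idem_sum3.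
  move=> r v; have := Fp a r v.
  by rewrite !special_opD !special_opZ !mulmxDl !formDr -!scalemxAl !formZr.
have wl l : 0 <= diag_entry w l by exact: psd_diag_entry.
have wu l : diag_entry w l <= onorm a * ((i == l)%:R + (j == l)%:R).
  have := psd_diag_entry l pw'.
  rewrite diag_entryD diag_entryZ diag_entryD !diag_entry_idem -scaleN1r.
  by rewrite diag_entryZ mulN1r subr_ge0.
have wk : diag_entry w k = 0.
  apply/eqP; rewrite eq_le wl andbT; have := wu k.
  by rewrite (negPf ik) (negPf jk) addr0 mulr0.
have [z zE] := Fw w (fun l => psd_row0 l pw wk).
set al := diag_entry w i in zE; set be := diag_entry w j in zE.
have MM : M (F a) *m M (F a) = al *: P i + be *: P j.
  have zM : M (F z) = M (F a) *m M (F a) - (al *: P i + be *: P j).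
    by rewrite wE zE !special_opD !special_opZ addrC addKr.
  have [zi zj zk _] := offdiag_struct ij ik jk (Fp z).
  have mi : M (F a) *m M (F a) *m P i = P i *m (M (F a) *m M (F a)).
    by rewrite -mulmxA MPi mulmxA MPj mulmxA.
  have mj : M (F a) *m M (F a) *m P j = P j *m (M (F a) *m M (F a)).
    by rewrite -mulmxA MPj mulmxA MPi mulmxA.
  have ei : M (F z) *m P i = 0.
    rewrite -(idem_sq i) mulmxA zi zM mulmxBr mulmxBl.
    have -> : P j *m (M (F a) *m M (F a)) *m P i = 0.
      by rewrite -mulmxA mi (mulmxA (P j)) idem_orth // mul0mx.
    rewrite sub0r.
    rewrite mulmxDr mulmxDl -!scalemxAr -!scalemxAl idem_orth // idem_sq.
    by rewrite idem_orth // mul0mx !scaler0 addr0 oppr0.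
  have ej : M (F z) *m P j = 0.
    rewrite -(idem_sq j) mulmxA zj zM mulmxBr mulmxBl.
    have -> : P i *m (M (F a) *m M (F a)) *m P j = 0.
      by rewrite -mulmxA mj (mulmxA (P i)) idem_orth // mul0mx.
    rewrite sub0r.
    rewrite mulmxDr mulmxDl -!scalemxAr -!scalemxAl idem_sq.
    by rewrite !idem_orth // mul0mx !scaler0 addr0 oppr0.
  apply/eqP; rewrite -subr_eq0 -zM; apply/eqP.
  by rewrite -[LHS]mulmx1 -(idem_sum3 ij ik jk) !mulmxDr ei ej zk !addr0.
have lower i' j' c : [|| (i' == i) && (j' == j) | (i' == j) && (j' == i)] ->
    M (F a) *m P i' = P j' *m M (F a) -> M (F a) *m P j' = P i' *m M (F a) ->
    M (F a) *m M (F a) *m P i' = c *: P i' -> 0 <= c -> onorm a <= c.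
  move=> ij' Mi Mj MMi c0; rewrite leNgt; apply/negP => cq.
  pose t := (c + onorm a) / 2; have ct : c < t by rewrite /t; lra.
  have [i'j' i'k j'k] : [/\ i' != j', i' != k & j' != k].
    by case/orP: ij' => /andP[/eqP -> /eqP ->].
  have : exceptional_cone R
      (diag_idem R i' + t *: diag_idem R j' + diag_idem R k + F a).
    apply/special_op_cone => u u0; rewrite !special_opD special_opZ.
    apply: (block_pos (a := c) D_sym D_pos) => //; rewrite ?idem_sq //;
      try exact: special_op_sa.
    exact: idem_sum3.
  move=> h; have := cone_minor i j h.
  rewrite !diag_entryD !diag_entryZ !diag_entry_idem !F0 !albertDE albertZ.
  rewrite !(albert_diag_idem_offdiag _ ij) scaler0 !add0r FN.
  have ki : (k == i) = false by rewrite eq_sym (negPf ik).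
  have kj : (k == j) = false by rewrite eq_sym (negPf jk).
  case/orP: ij' => /andP[/eqP -> /eqP ->].
    by rewrite !eqxx (negPf ij) (negPf ji) ki kj /= /t; lra.
  by rewrite !eqxx (negPf ij) (negPf ji) ki kj /= /t; lra.
have ale : al = onorm a.
  apply/eqP; rewrite eq_le; apply/andP; split.
    by have := wu i; rewrite eqxx (negPf ji) addr0 mulr1.
  apply: (lower i j) => //; [by rewrite !eqxx | | exact: wl].
  by rewrite MM mulmxDl -!scalemxAl idem_sq idem_orth // scaler0 addr0.
have bee : be = onorm a.
  apply/eqP; rewrite eq_le; apply/andP; split.
    by have := wu j; rewrite eqxx (negPf ij) add0r mulr1.
  apply: (lower j i) => //; [by rewrite !eqxx orbT | | exact: wl].
  by rewrite MM mulmxDl -!scalemxAl idem_sq idem_orth // scaler0 add0r.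
by rewrite MM ale bee scalerDr.
Qed.

Lemma oreal0 : oreal 0 = 0 :> octonion R. Proof. by []. Qed.

Lemma onorm1 : onorm (oreal (1 : R)) = 1. Proof. by rewrite /=; ring. Qed.

Lemma oconj1 : oconj (oreal (1 : R)) = oreal 1.
Proof. by rewrite /oconj /oreal /cd_conj /=; repeat congr pair; rewrite /= oppr0. Qed.

Lemma off01_family : peirce_family ix0 ix1 ix2 (@off01 R).
Proof.
split=> [a l|a|a r|w h].
- by rewrite diag_entry_herm3; case: (ord3P l) => ->.
- by rewrite albert_herm3.
- by rewrite -[a]oconjK onorm_conj -rank1_01; exact: psd_rank1.
exists (albert w ix0 ix1); rewrite [LHS]herm3_eta herm3E.
have := h ix2; rewrite albert_diag -oreal0 => -[->].
rewrite (albert_herm w ix2 ix0) (albert_herm w ix2 ix1) !h oconj0.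
rewrite off02_0 off12_0.
by rewrite scale0r !addr0.
Qed.

Lemma off02_family : peirce_family ix0 ix2 ix1 (@off02 R).
Proof.
split=> [a l|a|a r|w h].
- by rewrite diag_entry_herm3; case: (ord3P l) => ->.
- by rewrite albert_herm3.
- by rewrite -[a]oconjK onorm_conj -rank1_02; exact: psd_rank1.
exists (albert w ix0 ix2); rewrite [LHS]herm3_eta herm3E.
have := h ix1; rewrite albert_diag -oreal0 => -[->].
rewrite (albert_herm w ix1 ix0) !h oconj0 off01_0 off12_0.
by rewrite scale0r !addr0.
Qed.

Lemma off12_psd a : peirce_psd ix2 ix1 (onorm a) (off12 a).
Proof. by move=> r; rewrite -rank1_12; exact: psd_rank1. Qed.

Local Notation A x := (M (off01 x)).
Local Notation B x := (M (off02 x)).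
Local Notation E x := (M (off12 x)).

(** For v = (1,a,b), evaluate the form of M(v v* ) at x + y - s, where x and y are
    in the images of P_1 and P_2 and s = X x + Y y in the image of P_0 is the
    minimizing choice.  By [offdiag_sq] all the squares cancel and only twice
    (Z y, x) - (Y y, X x) is left; being nonnegative and odd in x, it is 0. *)
Lemma schur_product a b :
  P ix1 *m E (omul a (oconj b)) *m P ix2 =
  P ix1 *m A (oconj a) *m B (oconj b) *m P ix2.
Proof.
have [A0 A1 A2 _] := offdiag_struct (i := ix0) (j := ix1) (k := ix2) isT isT isT
  (let: And4 _ _ h _ := off01_family in h (oconj a)).
have [B0 B2 B1 _] := offdiag_struct (i := ix0) (j := ix2) (k := ix1) isT isT isT
  (let: And4 _ _ h _ := off02_family in h (oconj b)).
have [E2 E1 E0 _] := offdiag_struct (i := ix2) (j := ix1) (k := ix0) isT isT isT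
  (off12_psd (omul a (oconj b))).
have AA := @offdiag_sq ix0 ix1 ix2 _ (oconj a) isT isT isT off01_family.
have BB := @offdiag_sq ix0 ix2 ix1 _ (oconj b) isT isT isT off02_family.
rewrite !onorm_conj in AA BB.
set X := A _ in A0 A1 A2 AA *; set Y := B _ in B0 B1 B2 BB *.
set Z := E _ in E0 E1 E2 *.
have sX : self_adj D X := special_op_sa _; have sY : self_adj D Y := special_op_sa _.
have sZ : self_adj D Z := special_op_sa _.
have ge (v w : 'cV[R]_n) : 0 <= f (P ix1 *m v) (Z *m (P ix2 *m w)) -
    f (P ix1 *m v) (X *m (Y *m (P ix2 *m w))).
  set x := P ix1 *m v; set y := P ix2 *m w.
  have Px : P ix1 *m x = x by rewrite mulmxA idem_sq.
  have Py : P ix2 *m y = y by rewrite mulmxA idem_sq.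
  have P0x : P ix0 *m x = 0 by rewrite mulmxA idem_orth // mul0mx.
  have P2x : P ix2 *m x = 0 by rewrite mulmxA idem_orth // mul0mx.
  have P0y : P ix0 *m y = 0 by rewrite mulmxA idem_orth // mul0mx.
  have P1y : P ix1 *m y = 0 by rewrite mulmxA idem_orth // mul0mx.
  have Xx : X *m x = P ix0 *m (X *m x) by rewrite mulmxA -A1 -mulmxA Px.
  have Yy : Y *m y = P ix0 *m (Y *m y) by rewrite mulmxA -B2 -mulmxA Py.
  pose s := X *m x + Y *m y.
  have Ps : P ix0 *m s = s by rewrite mulmxDr -Xx -Yy.
  have P1s : P ix1 *m s = 0 by rewrite -Ps mulmxA idem_orth // mul0mx.
  have P2s : P ix2 *m s = 0 by rewrite -Ps mulmxA idem_orth // mul0mx.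
  pose u := x + y - s.
  have u0 : P ix0 *m u = - s by rewrite mulmxDr mulmxN mulmxDr P0x P0y Ps !add0r.
  have u1 : P ix1 *m u = x.
    by rewrite mulmxDr mulmxN mulmxDr Px P1y P1s oppr0 !addr0.
  have u2 : P ix2 *m u = y.
    by rewrite mulmxDr mulmxN mulmxDr Py P2x P2s oppr0 addr0 add0r.
  have fX : f u (X *m u) = - f s (X *m x) *+ 2.
    rewrite (@block_form _ _ D D_sym (P ix1) (P ix0) (P ix2)) ?idem_sq //.
    - by rewrite u0 u1 formNl.
    - exact: special_op_sa.
    - exact: idem_sum3.
  have fY : f u (Y *m u) = - f s (Y *m y) *+ 2.
    rewrite (@block_form _ _ D D_sym (P ix2) (P ix0) (P ix1)) ?idem_sq //.
    - by rewrite u0 u2 formNl.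
    - exact: special_op_sa.
    - exact: idem_sum3.
  have fZ : f u (Z *m u) = f x (Z *m y) *+ 2.
    rewrite (@block_form _ _ D D_sym (P ix2) (P ix1) (P ix0)) ?idem_sq //.
    - by rewrite u1 u2.
    - exact: special_op_sa.
    - exact: idem_sum3.
  have f0 : f u (P ix0 *m u) = f s s.
    by rewrite (form_proj _ (special_op_sa _) (idem_sq _)) u0 formNl formNr opprK.
  have f1 : f u (P ix1 *m u) = f x x.
    by rewrite (form_proj _ (special_op_sa _) (idem_sq _)) u1.
  have f2 : f u (P ix2 *m u) = f y y.
    by rewrite (form_proj _ (special_op_sa _) (idem_sq _)) u2.
  have XX : f (X *m x) (X *m x) = onorm a * f x x.
    by rewrite sX mulmxA AA -scalemxAl mulmxDl P0x Px add0r formZr.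
  have YY : f (Y *m y) (Y *m y) = onorm b * f y y.
    by rewrite sY mulmxA BB -scalemxAl mulmxDl P0y Py add0r formZr.
  have YX : f (Y *m y) (X *m x) = f (X *m x) (Y *m y) by exact: form_swap.
  have := psd_rank1 1 a b u.
  rewrite /rank1_herm herm3E !scale1r !special_opD !special_opZ.
  rewrite !mulmxDl !formDr -!scalemxAl.
  rewrite !formZr f0 f1 f2 fX fY fZ /s !formDl !formDr XX YY YX sX expr1n.
  lra.
have eq0 (v w : 'cV[R]_n) : f (P ix1 *m v) (Z *m (P ix2 *m w)) =
    f (P ix1 *m v) (X *m (Y *m (P ix2 *m w))).
  apply/eqP; rewrite -subr_eq0 eq_le ge andbT -oppr_ge0 opprB.
  by have := ge (- v) w; rewrite mulmxN !formNl; lra.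
apply: mulmx_ext => w; set p := Z *m (P ix2 *m w).
set q := X *m (Y *m (P ix2 *m w)).
have -> : P ix1 *m Z *m P ix2 *m w = P ix1 *m p by rewrite /p !mulmxA.
have -> : P ix1 *m X *m Y *m P ix2 *m w = P ix1 *m q by rewrite /q !mulmxA.
apply/eqP; rewrite -subr_eq0 -mulmxBr; apply/eqP; apply: (form_eq0 D_pos).
rewrite -(form_proj _ (special_op_sa _) (idem_sq _)) -special_op_sa formDr formNr.
by rewrite eq0 subrr.
Qed.

(** With s(x) the block of M(off12 x) between the images of P_1 and P_2,
    [schur_product] reads s(xy) = s(x) K s(y), since the operators of the
    off-diagonal units are partial isometries between the blocks.  So s carries
    the two bracketings of a triple product to the same operator. *)
Lemma albert_not_special : False.
Proof.
have one_sq i j k F : i != j -> i != k -> j != k -> peirce_family i j k F ->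
    M (F (oreal 1)) *m P j *m M (F (oreal 1)) = P i.
  move=> ij ik jk h; have [_ _ hp _] := h.
  have [Mi Mj _ _] := offdiag_struct ij ik jk (hp (oreal 1)).
  have := offdiag_sq (oreal 1) ij ik jk h; rewrite onorm1 scale1r => MM.
  by rewrite Mj -mulmxA MM mulmxDr idem_sq idem_orth // addr0.
pose s (x : octonion R) := P ix1 *m E x *m P ix2.
pose K := P ix2 *m B (oreal 1) *m A (oreal 1) *m P ix1.
have s1 (x y : octonion R) : s (omul x y) = P ix1 *m A (oconj x) *m B y *m P ix2.
  by rewrite /s -{1}(oconjK y) schur_product oconjK.
have sM (x y : octonion R) : s (omul x y) = s x *m K *m s y.
  rewrite s1 -{2}(omulr1 x) -[in RHS](omul1r y) !s1 oconj1 /K.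
  have -> : P ix1 *m A (oconj x) *m B (oreal 1) *m P ix2 *m
     (P ix2 *m B (oreal 1) *m A (oreal 1) *m P ix1) *m
     (P ix1 *m A (oreal 1) *m B y *m P ix2) =
    P ix1 *m A (oconj x) *m (B (oreal 1) *m (P ix2 *m P ix2) *m B (oreal 1)) *m
     (A (oreal 1) *m (P ix1 *m P ix1) *m A (oreal 1)) *m B y *m P ix2.
    by rewrite !mulmxA.
  rewrite !idem_sq (one_sq _ _ _ _ _ _ _ off01_family) //.
  rewrite (one_sq _ _ _ _ _ _ _ off02_family) //.
  have [_ _ hp _] := off01_family.
  have [A0 _ _ _] := offdiag_struct (i := ix0) (j := ix1) (k := ix2)
    isT isT isT (hp (oconj x)).
  rewrite -(mulmxA _ (P ix0) (P ix0)) idem_sq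
    -(mulmxA (P ix1) (A (oconj x)) (P ix0)) A0.
  by rewrite (mulmxA (P ix1) (P ix1)) idem_sq.
have s0 (x : octonion R) : s x = 0 -> x = 0.
  move=> sx; have [E2 E1 E0 _] :=
    offdiag_struct (i := ix2) (j := ix1) (k := ix0) isT isT isT (off12_psd x).
  have e2 : E x *m P ix2 = 0.
    by rewrite -{1}(idem_sq ix2) mulmxA E2.
  have e1 : E x *m P ix1 = 0.
    rewrite E1; apply: mulmx_ext => u; rewrite mul0mx.
    rewrite -(mulmxA (P ix2) (E x) u); apply: (form_eq0 D_pos).
    by rewrite special_op_sa special_op_sa (mulmxA (E x) (P ix2)) e2 mul0mx form0r.
  have : E x = 0.
    by rewrite -[LHS]mulmx1 -idem_sum !mulmxDr E0 e1 e2 !addr0.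
  move=> /special_op_inj h; have := albert_herm3 0 0 0 0 0 x ix1 ix2.
  rewrite -/(off12 x) h /= => <-.
  by rewrite -[0](scale0r 0) albertZ scale0r.
have [x [y [z]]] := omul_nonassoc R; apply.
apply/eqP; rewrite -subr_eq0; apply/eqP; apply: s0.
rewrite /s off12B special_opB mulmxBr mulmxBl -!/(s _) !sM !mulmxA; exact: subrr.
Qed.
End Special.

(** * Unordered sums of complex numbers *)

(** The norm of C R takes its values in C R; this is the same number in R. *)
Definition cabs (R : realType) (z : C R) : R := complex.Re `|z|.

Lemma cabsE (R : realType) (z : C R) : `|z| = (real_complex R (cabs z) : C R).
Proof. by rewrite /cabs normc_def. Qed.

Lemma cabs_sqrt (R : realType) (z : C R) :
  cabs z = Num.sqrt (complex.Re z ^+ 2 + complex.Im z ^+ 2).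
Proof. by rewrite /cabs normc_def. Qed.

Section UnorderedSums.
Context (R : realType) (I : choiceType).

Lemma ge0_sum_lim (g : I -> R) (B : R) : (forall i, 0 <= g i) ->
  (forall A : {fset I}, \sum_(i <- A) g i <= B) ->
  exists s, forall e, 0 < e -> exists A0 : {fset I}, forall A : {fset I},
    (A0 `<=` A)%fset -> `|s - \sum_(i <- A) g i| < e.
Proof.
move=> g0 gB; pose E := range (fun A : {fset I} => \sum_(i <- A) g i).
have supE : has_sup E.
  split; first by exists (\sum_(i <- fset0) g i); exists fset0.
  by exists B => _ [A _ <-].
exists (sup E) => e e0; have [_ [A0 _ <-] sA0] := sup_adherent e0 supE.
exists A0 => A A0A.
have mono : \sum_(i <- A0) g i <= \sum_(i <- A) g i.
  rewrite (big_fsetID _ (mem A0) A) /=.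
  have -> : [fset x in A | x \in A0]%fset = A0.
    apply/fsetP => x; rewrite !inE /= andbC; case xA: (x \in A0) => //=.
    exact: (fsubsetP A0A).
  by rewrite lerDl sumr_ge0.
have le : \sum_(i <- A) g i <= sup E by apply: ub_le_sup; [case: supE|exists A].
by rewrite ger0_norm ?subr_ge0 //; lra.
Qed.

Lemma abs_sum_lim (g : I -> R) (B : R) :
  (forall A : {fset I}, \sum_(i <- A) `|g i| <= B) ->
  exists s, forall e, 0 < e -> exists A0 : {fset I}, forall A : {fset I},
    (A0 `<=` A)%fset -> `|s - \sum_(i <- A) g i| < e.
Proof.
move=> gB.
have [s hs] := @ge0_sum_lim (fun i => `|g i|) B (fun i => normr_ge0 _) gB.
have [|A|t ht] := @ge0_sum_lim (fun i => `|g i| - g i) (B + B).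
- by move=> i; rewrite subr_ge0 ler_norm.
- rewrite sumrB lerD // -sumrN; apply: le_trans (gB A).
  by apply: ler_sum => i _; rewrite -normrN ler_norm.
exists (s - t) => e e0; have e2 : 0 < e / 2 by lra.
have [A1 h1] := hs _ e2; have [A2 h2] := ht _ e2.
exists (A1 `|` A2)%fset => A; rewrite fsubUset => /andP[/h1 + /h2].
rewrite sumrB => k1 k2.
have -> : s - t - \sum_(i <- A) g i = (s - \sum_(i <- A) `|g i|) -
   (t - (\sum_(i <- A) `|g i| - \sum_(i <- A) g i)) by ring.
by rewrite (le_lt_trans (ler_normB _ _)) //; lra.
Qed.

Lemma normC_ReIm (z : C R) :
  `|z| <= (real_complex R (`|complex.Re z| + `|complex.Im z|) : C R).
Proof.
rewrite normc_def lecR -(ler_pXn2r (n := 2)) ?nnegrE ?sqrtr_ge0 ?addr_ge0 //.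
rewrite sqr_sqrtr ?addr_ge0 ?sqr_ge0 // sqrrD !real_normK ?num_real //.
by rewrite lerD2r lerDl mulrn_wge0 // mulr_ge0.
Qed.

Lemma Re_le_norm (z : C R) : `|complex.Re z| <= cabs z.
Proof.
rewrite cabs_sqrt -(ler_pXn2r (n := 2)) ?nnegrE ?sqrtr_ge0 //.
by rewrite sqr_sqrtr ?addr_ge0 ?sqr_ge0 // real_normK ?num_real // lerDl sqr_ge0.
Qed.

Lemma Im_le_norm (z : C R) : `|complex.Im z| <= cabs z.
Proof.
rewrite cabs_sqrt -(ler_pXn2r (n := 2)) ?nnegrE ?sqrtr_ge0 //.
by rewrite sqr_sqrtr ?addr_ge0 ?sqr_ge0 // real_normK ?num_real // lerDr sqr_ge0.
Qed.

Lemma Re_sum (A : {fset I}) (f : I -> C R) :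
  complex.Re (\sum_(i <- A) f i) = \sum_(i <- A) complex.Re (f i).
Proof. by apply: (big_morph (@complex.Re R)) => //; case=> a b [c d]. Qed.

Lemma Im_sum (A : {fset I}) (f : I -> C R) :
  complex.Im (\sum_(i <- A) f i) = \sum_(i <- A) complex.Im (f i).
Proof. by apply: (big_morph (@complex.Im R)) => //; case=> a b [c d]. Qed.

(** The bound gives both the convergence of the unordered sum and its distance
    to the term of index i0. *)
Lemma sum_near (f : I -> C R) (i0 : I) (eps : R) :
  (forall A : {fset I}, i0 \notin A -> \sum_(i <- A) cabs (f i) <= eps) ->
  `|summability.sum f - f i0| <= (real_complex R eps : C R).
Proof.
move=> h; pose B := cabs (f i0) + eps.
have n0 (z : C R) : 0 <= cabs z by rewrite cabs_sqrt sqrtr_ge0.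
have fB (A : {fset I}) : \sum_(i <- A) cabs (f i) <= B.
  have := h (A `\ i0)%fset; rewrite !inE eqxx => /(_ isT) hA.
  have [iA|iA] := boolP (i0 \in A); first by rewrite (big_fsetD1 i0) //= lerD2l.
  by rewrite /B -[leLHS]add0r lerD // h.
have [a ha] := @abs_sum_lim (fun i => complex.Re (f i)) B
  (fun A => le_trans (ler_sum _ (fun i _ => Re_le_norm (f i))) (fB A)).
have [b hb] := @abs_sum_lim (fun i => complex.Im (f i)) B
  (fun A => le_trans (ler_sum _ (fun i _ => Im_le_norm (f i))) (fB A)).
pose s : C R := (a +i* b)%C.
have psE (A : {fset I}) : summability.partial_sum f A = \sum_(i <- A) f i.
  by rewrite big_seq_fsetE.
have near (e : R) : 0 < e -> exists A0 : {fset I}, forall A : {fset I},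
    (A0 `<=` A)%fset -> `|s - \sum_(i <- A) f i| < (real_complex R e : C R).
  move=> e0; have e2 : 0 < e / 2 by lra.
  have [A1 h1] := ha _ e2; have [A2 h2] := hb _ e2.
  exists (A1 `|` A2)%fset => A; rewrite fsubUset => /andP[/h1 + /h2].
  rewrite -Re_sum -Im_sum; move: (\sum_(i <- A) f i) => [x y] /= k1 k2.
  by rewrite (le_lt_trans (normC_ReIm _)) // ltcR /=; lra.
have FF : ProperFilter (@summability.totally I) by exact: summability.totally_filter.
have cv : summability.partial_sum f @ summability.totally --> (s : C R).
  apply/cvgrPdist_lt => e e0.
  have : e \is Num.real by exact: gtr0_real.
  move=> /complex_realP[r er]; rewrite er ltcR in e0.
  have [A0 hA] := near r e0; exists A0 => //= A A0A /=.
  by rewrite psE er; exact: hA.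
have -> : summability.sum f = s by apply: cvg_lim.
apply/ler_addgt0Pr => e e0.
have : e \is Num.real by exact: gtr0_real.
move=> /complex_realP[r er]; rewrite er ltcR in e0.
have [A0 hA] := near r e0; pose A := (i0 |` A0)%fset.
have /hA sA : (A0 `<=` A)%fset by exact: fsubsetUr.
have -> : s - f i0 = (s - \sum_(i <- A) f i) + \sum_(i <- (A `\ i0)%fset) f i.
  rewrite (big_fsetD1 i0) /=; last by rewrite !inE eqxx.
  by ring.
rewrite er addrC (le_trans (ler_normD _ _)) // lerD //; last exact: ltW.
apply: le_trans (ler_norm_sum _ _ _) _.
have -> : \sum_(i <- (A `\ i0)%fset) `|f i| =
    (real_complex R (\sum_(i <- (A `\ i0)%fset) cabs (f i)) : C R).
  by rewrite rmorph_sum; apply: eq_bigr => i _; exact: cabsE.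
by rewrite lecR h // !inE eqxx.
Qed.
End UnorderedSums.

(** * Gaussian bounds and the exponential *)

Section GaussianBound.
Context (R : realType).

Lemma geometric_le2 (r : R) N : 0 < r -> r <= 2^-1 -> \sum_(i < N) r ^+ i <= 2.
Proof.
move=> r0 r2; have := subrX1 r N => e.
have : 0 <= r ^+ N by rewrite exprn_ge0 // ltW.
have : 0 <= \sum_(i < N) r ^+ i.
  by apply: sumr_ge0 => i _; rewrite exprn_ge0 // ltW.
nra.
Qed.

Lemma sum_uniq_le (T : finType) (s : seq T) (F : T -> R) :
  (forall x, 0 <= F x) -> uniq s -> \sum_(x <- s) F x <= \sum_x F x.
Proof.
move=> F0 us; rewrite big_uniq // [leRHS](bigID (mem s)) /=.
by rewrite lerDl sumr_ge0.
Qed.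

(** An integer vector is encoded by the signs and the absolute values of its
    coordinates, which turns the sum into part of a product of n finite
    geometric sums, each counted twice. *)
Lemma int_vec_sum n (r : R) (s : seq 'cV[int]_n) : 0 < r -> r <= 2^-1 ->
  uniq s -> \sum_(k <- s) \prod_i r ^+ `|k i 0%R|%N <= 4 ^+ n.
Proof.
move=> r0 r2 us.
pose N := (\max_(k <- s) \max_i `|k i 0%R|)%N.
have kN k i : k \in s -> (`|k i 0%R| < N.+1)%N.
  move=> ks; rewrite ltnS /N (big_rem k) //= leq_max.
  by rewrite (leq_bigmax i).
pose phi (k : 'cV[int]_n) : {ffun 'I_n -> bool * 'I_N.+1} :=
  [ffun i => (k i 0 < 0, inord `|k i 0%R|%N)].
pose w (g : {ffun 'I_n -> bool * 'I_N.+1}) : R := \prod_i r ^+ (g i).2.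
have -> : \sum_(k <- s) \prod_i r ^+ `|k i 0%R|%N = \sum_(g <- map phi s) w g.
  rewrite big_map; apply: eq_big_seq => k ks; apply: eq_bigr => i _.
  by rewrite ffunE /= inordK // kN.
have w0 g : 0 <= w g by apply: prodr_ge0 => i _; rewrite exprn_ge0 // ltW.
apply: le_trans (sum_uniq_le w0 _) _.
  rewrite map_inj_in_uniq // => k l ks ls e; apply/colP => i.
  have := congr1 (fun g : {ffun 'I_n -> bool * 'I_N.+1} => g i) e.
  rewrite !ffunE => -[es ea].
  have ea' : `|k i 0%R|%N = `|l i 0%R|%N.
    by have := congr1 val ea; rewrite /= !inordK // kN.
  by rewrite (intEsign (k i 0)) (intEsign (l i 0)) es ea'.
rewrite /w -(bigA_distr_bigA (fun _ (p : bool * 'I_N.+1) => r ^+ p.2)) /=.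
rewrite prodr_const card_ord lerXn2r ?nnegrE //.
  by apply: sumr_ge0 => p _; rewrite exprn_ge0 // ltW.
rewrite -(pair_bigA _ (fun (b : bool) (i : 'I_N.+1) => r ^+ i)) /=.
rewrite big_bool /=; have := geometric_le2 N.+1 r0 r2; lra.
Qed.

Definition norm1 n (k : 'cV[R]_n) : R := \sum_i `|k i 0|.

Lemma norm1_ge0 n (k : 'cV[R]_n) : 0 <= norm1 k.
Proof. by apply: sumr_ge0. Qed.

Lemma row_le_norm1 n (b : 'rV[R]_n) (k : 'cV[R]_n) :
  `|(b *m k) 0 0| <= (\sum_i `|b 0 i|) * norm1 k.
Proof.
rewrite mxE (le_trans (ler_norm_sum _ _ _)) // mulr_sumr.
apply: ler_sum => i _; rewrite normrM; apply: ler_wpM2r => //.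
by rewrite (bigD1 i) //= lerDl sumr_ge0.
Qed.

(** Each coordinate k_i is the W-product of k with the fixed vector
    W^-1 e_i, so that it is controlled by Cauchy-Schwarz for W, without any
    compactness. *)
Lemma pd_coercive n (W : 'M[R]_n) : W^T = W ->
  (forall u : 'cV[R]_n, u != 0 -> 0 < form W u u) ->
  exists2 c : R, 0 < c & forall k, c * norm1 k ^+ 2 <= form W k k.
Proof.
move=> Ws Wp; have Wu := pd_unit Wp.
pose v i : 'cV[R]_n := invmx W *m delta_mx i 0.
pose d := \sum_i Num.sqrt (form W (v i) (v i)).
have d0 : 0 <= d by apply: sumr_ge0 => i _; rewrite sqrtr_ge0.
have q0 (k : 'cV[R]_n) : 0 <= form W k k by exact: form_ge0 Wp _.
have ki (k : 'cV[R]_n) i :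
    `|k i 0| <= Num.sqrt (form W (v i) (v i)) * Num.sqrt (form W k k).
  have -> : k i 0 = form W (v i) k.
    rewrite /form /v trmx_mul trmx_inv Ws -(mulmxA _ (invmx W)) mulVmx // mulmx1.
    by rewrite trmx_delta -rowE mxE.
  rewrite -sqrtrM // -sqrtr_sqr ler_wsqrtr //.
  have := @psd_cauchy _ _ W Ws 1%:M (v i) k.
  rewrite !mul1mx; apply; first by move=> x y; rewrite !mul1mx.
  by move=> x; rewrite mul1mx.
have le (k : 'cV[R]_n) : norm1 k <= d * Num.sqrt (form W k k).
  by rewrite /norm1 /d mulr_suml; apply: ler_sum.
exists (1 + d ^+ 2)^-1; first by rewrite invr_gt0 ltr_pwDl ?sqr_ge0.
move=> k; rewrite ler_pdivrMl ?ltr_pwDl ?sqr_ge0 //.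
have : norm1 k ^+ 2 <= (d * Num.sqrt (form W k k)) ^+ 2.
  by rewrite lerXn2r ?nnegrE ?norm1_ge0 // mulr_ge0 ?sqrtr_ge0.
by rewrite exprMn sqr_sqrtr //; have := q0 k; nra.
Qed.
End GaussianBound.

Section Exponential.
Context (R : realType).
Implicit Types (z w : C R).

Lemma cexpD z w : cexp (z + w) = cexp z * cexp w.
Proof.
case: z => a b; case: w => c d; rewrite /cexp /= expRD cosD sinD.
apply/eqP; rewrite eq_complex /=; apply/andP; split; apply/eqP; ring.
Qed.

Lemma exp_ipiD z w : exp_ipi (z + w) = exp_ipi z * exp_ipi w.
Proof. by rewrite /exp_ipi mulrDr cexpD. Qed.

Lemma exp_ipi0 : exp_ipi (0 : C R) = 1.
Proof.
rewrite /exp_ipi mulr0 /cexp /= expR0 cos0 sin0 mul1r mulr0.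
by apply/eqP; rewrite eq_complex /= !eqxx.
Qed.

Lemma exp_ipi_neq0 z : exp_ipi z != 0.
Proof.
apply/eqP => e; have := exp_ipiD z (- z); rewrite subrr exp_ipi0 e mul0r.
by move/eqP; rewrite oner_eq0.
Qed.

Lemma exp_ipiE (a b : R) : exp_ipi (a +i* b : C R)%C =
  ((expR (- (pi * b)) * cos (pi * a)) +i* (expR (- (pi * b)) * sin (pi * a)))%C.
Proof.
have e : (real_complex R pi : C R) * I_ R * (a +i* b : C R)%C =
    (- (pi * b) +i* (pi * a))%C.
  apply/eqP; rewrite eq_complex /=; apply/andP; split; apply/eqP; ring.
by rewrite /exp_ipi e.
Qed.

Lemma cabs_exp_ipi z : cabs (exp_ipi z) = expR (- (pi * complex.Im z)).
Proof.
case: z => a b; rewrite exp_ipiE cabs_sqrt /=.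
rewrite !exprMn -mulrDr cos2Dsin2 mulr1 sqrtr_sqr ger0_norm //; exact: expR_ge0.
Qed.

(** The case s = 1 shows that z is real; if z were not 0, s = 1/z would give
    cos pi = 1. *)
Lemma exp_ipi_scale_eq1 z : (forall s : R, exp_ipi (real_complex R s * z) = 1) ->
  z = 0.
Proof.
case: z => a b h.
have b0 : b = 0.
  have := congr1 (@cabs R) (h 1); rewrite rmorph1 mul1r cabs_exp_ipi.
  rewrite [RHS]cabs_sqrt /= expr1n expr0n addr0 sqrtr1 -(expR0 R) => /expR_inj.
  move/eqP; rewrite oppr_eq0 mulf_eq0 gt_eqF ?pi_gt0 //= => /eqP //.
apply/eqP; rewrite eq_complex /= b0 eqxx andbT; apply/negPn/negP => a0.
have := h a^-1.
have -> : real_complex R a^-1 * (a +i* b : C R)%C = (1 +i* 0 : C R)%C.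
  by apply/eqP; rewrite eq_complex /= b0 !mulr0 !mul0r subr0 addr0 mulVf // !eqxx.
rewrite exp_ipiE => /(congr1 (@complex.Re R)) /=.
rewrite mulr0 oppr0 expR0 mul1r mulr1 cospi; lra.
Qed.
End Exponential.

(** * Theta series of sparse lattices *)

Section Lattices.
Context (R : realType) (n : nat).

Definition lattice (B : 'M[R]_n) : set 'cV[R]_n :=
  [set B *m map_mx intr k | k in [set: 'cV[int]_n]].

Lemma lattice_full (B : 'M[R]_n) : B \in unitmx -> full_lattice (lattice B).
Proof. by move=> uB; exists B. Qed.

(** The two inclusions say that the columns of (B^T G)^-1 are the basis dual to
    the columns of B. *)
Lemma dual_latticeE (G B : 'M[R]_n) : G \in unitmx -> B \in unitmx ->
  dual_lattice G (lattice B) = lattice (invmx (B^T *m G)).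
Proof.
move=> uG uB; have uBG : B^T *m G \in unitmx by rewrite unitmx_mul unitmx_tr uB.
apply/seteqP; split => x /=.
  move=> h; exists (map_mx Num.floor (B^T *m G *m x)) => //.
  suff -> : map_mx intr (map_mx Num.floor (B^T *m G *m x)) = B^T *m G *m x.
    by rewrite mulKmx.
  apply/colP => i; rewrite !mxE; apply/eqP; rewrite -intrEfloor.
  have := h _ (ex_intro2 _ _ (delta_mx i 0) I erefl).
  rewrite /form map_delta_mx trmx_mul trmx_delta -!mulmxA -rowE mxE.
  by rewrite [in X in X -> _]mulmxA [in X in X -> _]mxE.
move=> [k _ <-] l [k' _ <-]; rewrite /form trmx_mul -!mulmxA.
rewrite (mulmxA G) (mulmxA B^T) (mulmxA B^T G) mulmxV // mul1mx mxE.
by rewrite rpred_sum // => i _; rewrite !mxE -intrM; exact: intr_int.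
Qed.
End Lattices.

Section ThetaData.
Context (R : realType) (m n : nat) (G : 'M[R]_n).
Context (psi : {linear 'cV[C R]_m -> 'M[C R]_n}) (e : 'cV[R]_m).
Hypothesis td : theta_data G psi e.

Let G_sym : G^T = G := rho_sym td.
Let G_pos := rho_pos td.

Lemma G_unit : G \in unitmx. Proof. exact: pd_unit G_pos. Qed.

Local Notation cx := (@complexify R _ _).

Lemma complexifyD p q (A B : 'M[R]_(p, q)) : cx (A + B) = cx A + cx B.
Proof. exact: map_mxD. Qed.

Lemma complexifyM p q r (A : 'M[R]_(p, q)) (B : 'M[R]_(q, r)) :
  cx (A *m B) = cx A *m cx B.
Proof. exact: map_mxM. Qed.

Lemma complexifyZ p q (a : R) (A : 'M[R]_(p, q)) :
  cx (a *: A) = (real_complex R a : C R) *: cx A.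
Proof. exact: map_mxZ. Qed.

Lemma complexify_inj p q : injective (@complexify R p q).
Proof. by apply: map_mx_inj; exact: complexI. Qed.

Lemma complexifyK p q (A : 'M[R]_(p, q)) : map_mx (@complex.Re R) (cx A) = A.
Proof. by apply/matrixP => i j; rewrite !mxE. Qed.

Lemma ReIm_mx p q (A : 'M[C R]_(p, q)) :
  A = cx (map_mx (@complex.Re R) A) + I_ R *: cx (map_mx (@complex.Im R) A).
Proof.
apply/matrixP => i j; rewrite !mxE; case: (A i j) => a b.
by apply/eqP; rewrite eq_complex /= !(mul0r, mulr0, mul1r, subr0, addr0, add0r) !eqxx.
Qed.

(** By self-adjointness psi(x) is a real matrix for real x, so that taking real
    parts loses nothing. *)
Definition real_op (x : 'cV[R]_m) : 'M[R]_n := map_mx (@complex.Re R) (psi (cx x)).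

Lemma psi_cx x : psi (cx x) = cx (real_op x).
Proof.
by rewrite /real_op; have [A -> _] := psi_self_adjoint td x; rewrite complexifyK.
Qed.

Lemma real_op_sa x : (real_op x)^T *m G = G *m real_op x.
Proof.
rewrite /real_op; have [A -> sA] := psi_self_adjoint td x; rewrite complexifyK.
by rewrite -{2}sA /adjoint !mulmxA mulmxV ?G_unit // mul1mx.
Qed.

Lemma real_opD x y : real_op (x + y) = real_op x + real_op y.
Proof. by apply: complexify_inj; rewrite complexifyD -!psi_cx complexifyD linearD. Qed.

Lemma real_opZ a x : real_op (a *: x) = a *: real_op x.
Proof. by apply: complexify_inj; rewrite complexifyZ -!psi_cx complexifyZ linearZ. Qed.

Definition gram x : 'M[R]_n := G *m real_op x.

Lemma gram_sym x : (gram x)^T = gram x.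
Proof. by rewrite /gram trmx_mul G_sym real_op_sa. Qed.

Lemma formC_cx (u v : 'cV[R]_n) :
  formC G (cx u) (cx v) = (real_complex R (form G u v) : C R).
Proof. by rewrite /formC /form /complexify matrix.map_trmx -!map_mxM mxE. Qed.

Lemma form_real_op x (u v : 'cV[R]_n) : form G (real_op x *m u) v = form (gram x) u v.
Proof. by rewrite /form /gram trmx_mul -!mulmxA (mulmxA _ G) real_op_sa !mulmxA. Qed.

Lemma cone_gram x : theta_cone G psi x <->
  (forall u : 'cV[R]_n, u != 0 -> 0 < form (gram x) u u).
Proof.
have E u : formC G (psi (cx x) *m cx u) (cx u) =
    (real_complex R (form (gram x) u u) : C R).
  by rewrite psi_cx -complexifyM formC_cx form_real_op.
by split => h u /h; rewrite E ltcR.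
Qed.

Lemma formC_real_r (u : 'cV[C R]_n) (v : 'cV[R]_n) :
  formC G u (cx v) = (form G (map_mx (@complex.Re R) u) v +i*
    form G (map_mx (@complex.Im R) u) v)%C.
Proof.
rewrite {1}(ReIm_mx u) /formC formDl formZl -!/(formC G _ _) !formC_cx.
by apply/eqP; rewrite eq_complex /= !(mul0r, mulr0, mul1r, subr0, addr0, add0r) !eqxx.
Qed.

Lemma Im_psi_mul (z : 'cV[C R]_m) (v : 'cV[R]_n) :
  map_mx (@complex.Im R) (psi z *m cx v) = real_op (map_mx (@complex.Im R) z) *m v.
Proof.
rewrite {1}(ReIm_mx z) linearD linearZ /= !psi_cx mulmxDl -scalemxAl -!complexifyM.
apply/colP => i; rewrite !mxE /=.
by rewrite !(mul0r, mulr0, mul1r, subr0, addr0, add0r).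
Qed.

Lemma Im_theta_exponent (z : 'cV[C R]_m) (u : 'cV[C R]_n) (v : 'cV[R]_n) :
  complex.Im (formC G (psi z *m cx v + u *+ 2) (cx v)) =
  form (gram (map_mx (@complex.Im R) z)) v v +
  form G (map_mx (@complex.Im R) u) v *+ 2.
Proof.
rewrite /formC formDl -!/(formC G _ _) !formC_real_r /= Im_psi_mul form_real_op.
congr (_ + _); rewrite [RHS]mulr2n -formDl; congr (form G _ v).
by apply/colP => i; rewrite !mxE; case: (u i 0).
Qed.

Lemma theta_near (L : set 'cV[R]_n) (B : 'M[R]_n) z u (r : R) :
  B \in unitmx -> dual_lattice G L = lattice B -> 0 < r -> r <= 2^-1 ->
  (forall k : 'cV[int]_n, k != 0 ->
     cabs (exp_ipi (formC G (psi z *m cx (B *m map_mx intr k) + u *+ 2)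
                            (cx (B *m map_mx intr k)))) <=
     r * \prod_i r ^+ `|k i 0%R|%N) ->
  `|theta G psi L z u - 1| <= (real_complex R (r * 4 ^+ n) : C R).
Proof.
move=> uB LB r0 r2 h; rewrite /theta LB.
set F := fun l : 'cV[R]_n => _.
have F0 : F 0 = 1.
  rewrite /F; have -> : (0 : 'cV[R]_n) \in lattice B.
    by rewrite inE; exists 0 => //; rewrite map_mx0 mulmx0.
  have -> : cx (0 : 'cV[R]_n) = 0 by exact: map_mx0.
  by rewrite /formC form0r exp_ipi0.
rewrite -F0; apply: sum_near => A A0.
pose kap (l : 'cV[R]_n) : 'cV[int]_n := map_mx Num.floor (invmx B *m l).
have kapK k : kap (B *m map_mx intr k) = k.
  by rewrite /kap mulKmx //; apply/colP => i; rewrite !mxE intrKfloor.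
have latK l : l \in lattice B -> B *m map_mx intr (kap l) = l.
  by rewrite inE => -[k _ <-]; rewrite kapK.
pose s := [seq l <- A | l \in lattice B].
have -> : \sum_(l <- A) cabs (F l) = \sum_(l <- s) cabs (F l).
  rewrite /s big_filter [RHS]big_mkcond; apply: eq_bigr => l _; rewrite /F.
  by case: ifP => // _; rewrite cabs_sqrt /= expr0n addr0 sqrtr0.
apply: le_trans (_ : \sum_(l <- s) r * \prod_i r ^+ `|kap l i 0%R|%N <= _).
  rewrite big_seq [leRHS]big_seq; apply: ler_sum => l.
  rewrite mem_filter => /andP[lB lA]; rewrite /F lB.
  rewrite -{1 2}(latK l lB); apply: h; apply/eqP => k0.
  move: lA; rewrite -(latK l lB) k0 map_mx0 mulmx0.
  by rewrite (negPf A0).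
rewrite -mulr_sumr ler_pM2l //.
rewrite -(big_map kap xpredT (fun k => \prod_i r ^+ `|k i 0%R|%N)).
apply: int_vec_sum => //; rewrite map_inj_in_uniq ?filter_uniq ?fset_uniq //.
move=> l l'; rewrite !mem_filter => /andP[lB _] /andP[lB' _] e'.
by rewrite -(latK l lB) -(latK l' lB') e'.
Qed.

(** With T = t + 1, the exponent at T B k has imaginary part at least
    T^2 c |k|^2 - 2 T bb |k| in the l^1 norm, which exceeds T (|k| + 1) as soon
    as k <> 0 and T is large; the terms are then dominated as [theta_near]
    requires, with r = exp (- T). *)
Lemma theta_sparse (L : nat -> set 'cV[R]_n) (B : 'M[R]_n) z u :
  B \in unitmx -> tube (theta_cone G psi) z ->
  (forall t, dual_lattice G (L t) = lattice (t.+1%:R *: B)) ->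
  theta G psi (L t) z u @[t --> \oo] --> (1 : C R).
Proof.
move=> uB zT LB; pose y := map_mx (@complex.Im R) z.
have gpos : forall v : 'cV[R]_n, v != 0 -> 0 < form (gram y) v v.
  by apply/cone_gram.
pose W := B^T *m gram y *m B.
have WE k : form W k k = form (gram y) (B *m k) (B *m k).
  by rewrite /form /W trmx_mul !mulmxA.
have [|k k0|c c0 hc] := @pd_coercive R n W.
- by rewrite /W trmx_mul (trmx_mul B^T (gram y)) trmxK gram_sym mulmxA.
- rewrite WE gpos //; apply: contra_neq k0 => e0.
  by rewrite -(mulKmx uB k) e0 mulmx0.
pose b : 'rV[R]_n := (map_mx (@complex.Im R) u)^T *m G *m B.
pose bb := \sum_i `|b 0 i|.
have bb0 : 0 <= bb by apply: sumr_ge0.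
have key t : (2 + bb *+ 2) / c <= t.+1%:R ->
   `|theta G psi (L t) z u - 1| <= (real_complex R (4 ^+ n * (t.+1%:R)^-1) : C R).
  set T : R := t.+1%:R => tbig; have T1 : 1 <= T by rewrite ler1n.
  have T0 : 0 < T by lra.
  have uTB : T *: B \in unitmx by rewrite unitmxZ // unitfE gt_eqF.
  have eT : (expR (- T)) <= T^-1 / 1.
    rewrite expRN divr1 lef_pV2 ?posrE ?expR_gt0 //.
    by have := expR_ge1Dx T; lra.
  have r2 : expR (- T) <= 2^-1.
    rewrite expRN lef_pV2 ?posrE ?expR_gt0 //.
    by have := expR_ge1Dx T; lra.
  apply: le_trans (theta_near (r := expR (- T)) uTB (LB t) (expR_gt0 _) r2 _) _.
    move=> k k0; rewrite cabs_exp_ipi Im_theta_exponent.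
    set kr : 'cV[R]_n := map_mx intr k.
    have E1 : form (gram y) (T *: B *m kr) (T *: B *m kr) = T ^+ 2 * form W kr kr.
      by rewrite -scalemxAl formZl formZr WE mulrA.
    have E2 : form G (map_mx (@complex.Im R) u) (T *: B *m kr) = T * (b *m kr) 0 0.
      by rewrite -scalemxAl formZr /form /b !mulmxA.
    rewrite -/y E1 E2.
    have n1 : norm1 kr = (\sum_i `|k i 0%R|%N)%:R.
      rewrite /norm1 natr_sum; apply: eq_bigr => i _; rewrite !mxE.
      by rewrite natr_absz intr_norm.
    have n11 : 1 <= norm1 kr.
      rewrite n1 ler1n lt0n; apply: contra_neqN k0 => /eqP s0.
      apply/colP => i; rewrite mxE; apply/eqP; rewrite -absz_eq0.
      by move/eqP: s0; rewrite sum_nat_eq0 => /forallP/(_ i).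
    rewrite -expr_sum -exprS -expRM_natl ler_expR -natr1 -n1.
    have hW := hc kr; have := row_le_norm1 b kr; rewrite -/bb.
    set q := form W kr kr in hW *; set be := (b *m kr) 0 0.
    set N := norm1 kr in n1 n11 hW *; rewrite ler_norml => /andP[hb _].
    have hT : 2 + bb *+ 2 <= T * c by rewrite -ler_pdivrMr.
    have h1 : T * (2 + bb *+ 2) * N ^+ 2 <= T * (T * q).
      rewrite -mulrA ler_pM2l //; apply: le_trans (_ : T * (c * N ^+ 2) <= _).
        by rewrite mulrA ler_wpM2r ?sqr_ge0.
      by rewrite ler_pM2l.
    have h2 : T * (- (bb * N)) <= T * be by rewrite ler_pM2l.
    have NN : N <= N ^+ 2 by rewrite expr2 ler_peMr // (le_trans ler01).
    have h3 : 0 <= T * bb * (N ^+ 2 - N).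
      by rewrite mulr_ge0 ?subr_ge0 // mulr_ge0 // ltW.
    have h4 : 0 <= T * (N ^+ 2 - N) by rewrite mulr_ge0 ?subr_ge0 // ltW.
    have h5 : 0 <= T * (N - 1) by rewrite mulr_ge0 ?subr_ge0 // ltW.
    have low : T * (N + 1) <= T ^+ 2 * q + (T * be) *+ 2 by nra.
    have pi1 : 1 <= pi :> R by have := pi_ge2 R; lra.
    have low0 : 0 <= T ^+ 2 * q + (T * be) *+ 2.
      by apply: le_trans low; rewrite mulr_ge0 ?(ltW T0) //; lra.
    have : T ^+ 2 * q + (T * be) *+ 2 <= pi * (T ^+ 2 * q + (T * be) *+ 2).
      by rewrite ler_peMl.
    lra.
  rewrite lecR mulrC ler_pM2l ?exprn_gt0 //.
  by move: eT; rewrite divr1.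
apply/cvgrPdist_le => d d0.
have : d \is Num.real by exact: gtr0_real.
move=> /complex_realP[r er]; rewrite er ltcR in d0 *.
have tS (t : nat) (a : R) : a <= t%:R -> a <= t.+1%:R.
  by move=> h; apply: le_trans h _; rewrite ler_nat.
near=> t; rewrite distrC; apply: le_trans (key t _) _.
  by apply: tS; near: t; exact: nbhs_infty_ger.
rewrite lecR ler_pdivrMr ?ltr0n // -ler_pdivrMl //.
by apply: tS; near: t; exact: nbhs_infty_ger.
Unshelve. all: by end_near.
Qed.
End ThetaData.

(** * Consequences of the transformation formula *)

Section MatrixFacts.

Lemma inj_unitmx (K : fieldType) n (A : 'M[K]_n) :
  (forall x : 'cV[K]_n, A *m x = 0 -> x = 0) -> A \in unitmx.
Proof.
move=> h; rewrite -unitmx_tr; apply/negPn/negP.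
rewrite unitmxE unitfE negbK => /det0P[v v0 vA].
move/eqP: v0; apply; apply: trmx_inj; rewrite linear0; apply: h.
by apply: trmx_inj; rewrite trmx_mul trmxK vA linear0.
Qed.

(** Replace by v the column i of the identity, where v_i <> 0; the result has
    determinant v_i, and its inverse is another rank one perturbation of the
    identity. *)
Lemma unit_with_column (K : fieldType) n (v : 'cV[K]_n) : v != 0 ->
  exists i (N : 'M[K]_n), N \in unitmx /\ N *m delta_mx i 0 = v.
Proof.
move=> v0; have [i vi] : exists i, v i 0 != 0.
  apply/existsP; apply: contraNT v0 => /existsPn h; apply/eqP/colP => i.
  by rewrite mxE; apply/eqP; have := h i; rewrite negbK.
pose a := v - delta_mx i 0; pose r : 'rV[K]_n := delta_mx 0 i.
have rv : r *m v = (v i 0)%:M by apply/matrixP => x y; rewrite !ord1 -rowE !mxE.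
have rd : r *m delta_mx i 0 = 1%:M.
  by apply/matrixP => x y; rewrite !ord1 -rowE !mxE !eqxx.
have ra : r *m a = (v i 0 - 1)%:M by rewrite mulmxBr rv rd raddfB.
exists i, (1%:M + a *m r); split; last first.
  by rewrite mulmxDl mul1mx -mulmxA rd mulmx1 addrC subrK.
have /mulmx1_unit[//] :
  (1%:M + a *m r) *m (1%:M - (v i 0)^-1 *: (a *m r)) = 1%:M.
rewrite mulmxDl mul1mx mulmxBr mulmx1 -scalemxAr -!mulmxA (mulmxA r) ra.
rewrite mul_scalar_mx -scalemxAr scalerA -addrA -[RHS]addr0; congr (_ + _).
rewrite -[X in _ + (X - _)]scale1r -scalerBl -scaleNr -scalerDl.
suff -> : - (v i 0)^-1 + (1 - (v i 0)^-1 * (v i 0 - 1)) = 0 by rewrite scale0r.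
by field.
Qed.

Lemma scalar_of_eigen (R : realType) n (X : 'M[C R]_n) :
  (forall v : 'cV[R]_n, exists l, X *m complexify v = l *: complexify v) ->
  exists l, X = l%:M.
Proof.
move=> h; have d a : complexify (delta_mx a 0 : 'cV[R]_n) = delta_mx a 0.
  by rewrite /complexify map_delta_mx.
have X0 a b : a != b -> X a b = 0.
  move=> ab; have [l] := h (delta_mx b 0); rewrite d -colE => /colP/(_ a).
  by rewrite !mxE (negPf ab) mulr0.
have Xd a b : X a a = X b b.
  have [->//|ab] := eqVneq a b.
  have [l] := h (delta_mx a 0 + delta_mx b 0).
  rewrite /complexify map_mxD -!/(complexify _) !d mulmxDr -!colE => /colP e.
  have := e a; have := e b; rewrite !mxE !eqxx (negPf ab) eq_sym (negPf ab).
  rewrite (X0 a b) // (X0 b a) 1?eq_sym //.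
  by rewrite /= !(addr0, add0r, mulr1) => -> ->.
case: n X {h d} X0 Xd => [|n] X X0 Xd.
  by exists 0; apply/matrixP => -[].
exists (X 0 0); apply/matrixP => a b; rewrite mxE.
by have [->|/X0 ->] := eqVneq a b; rewrite ?mulr1n.
Qed.
End MatrixFacts.

(** Passage to the limit in the identities that relate theta series of sparse
    lattices. *)
Lemma lim_eq (R : realType) (a b : C R) (x y : nat -> C R) :
  x @ \oo --> (1 : C R) -> y @ \oo --> (1 : C R) ->
  (forall t, x t * a = b * y t) -> a = b.
Proof.
move=> x1 y1 xy; have FF := eventually_filter.
have E : x \* (fun=> a) = (fun=> b) \* y by apply/funext => t; exact: xy.
have := @cvgM (C R) nat \oo FF x (fun=> a) 1 a x1 (@cvg_cst _ a _ _ FF).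
rewrite E => h1.
have h2 := @cvgM (C R) nat \oo FF (fun=> b) y b 1 (@cvg_cst _ b _ _ FF) y1.
have := cvg_unique (@norm_hausdorff _ _) h1 h2.
by rewrite (mul1r a) (mulr1 b); apply; exact: fmap_proper_filter.
Qed.

Lemma lim_mul1 (R : realType) (x y : nat -> C R) :
  x @ \oo --> (1 : C R) -> y @ \oo --> (1 : C R) ->
  (fun t => x t * y t) @ \oo --> (1 : C R).
Proof.
move=> x1 y1; have FF := eventually_filter.
have h := @cvgM (C R) nat \oo FF x y 1 1 x1 y1; rewrite mulr1 in h.
exact: h.
Qed.

Section Cocycle.
Context (R : realType) (m n : nat) (G : 'M[R]_n).
Context (psi : {linear 'cV[C R]_m -> 'M[C R]_n}) (e : 'cV[R]_m).
Context (j : 'cV[C R]_m -> 'cV[C R]_m) (J : 'cV[C R]_m -> 'M[C R]_n).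
Context (H : 'cV[C R]_m -> 'cV[C R]_n -> C R) (c : set 'cV[R]_n -> C R).
Hypothesis td : theta_data G psi e.
Hypothesis T2 : identity_T2 G psi.
Hypothesis T5 : identity_T5 G psi e j J H c.

Local Notation cx := (@complexify R _ _).
Local Notation tubeY := (tube (theta_cone G psi)).
Local Notation B := (formC G).
Local Notation dual := (dual_lattice G).
Let uG : G \in unitmx := G_unit td.

(** The factor of automorphy of (T2). *)
Definition theta_factor (z : 'cV[C R]_m) (u : 'cV[C R]_n) (v : 'cV[R]_n) : C R :=
  exp_ipi (- B (psi z *m cx v + u *+ 2) (cx v)).

Lemma dual_latticeK (N : 'M[R]_n) : N \in unitmx ->
  dual (dual (lattice N)) = lattice N.
Proof.
move=> uN; have uNG : N^T *m G \in unitmx by rewrite unitmx_mul unitmx_tr uN.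
rewrite dual_latticeE // dual_latticeE ?unitmx_inv //; congr lattice.
rewrite trmx_inv trmx_mul trmxK (rho_sym td).
have uGN : G *m N \in unitmx by rewrite unitmx_mul uG.
have -> : invmx (G *m N) *m G = invmx N; last by rewrite invmxK.
by rewrite -[LHS]mulmx1 -(mulmxV uN) mulmxA -(mulmxA _ G) mulVmx // mul1mx.
Qed.

Let BDl u v w : B (u + v) w = B u w + B v w := formDl (complexify G) u v w.
Let BZl a u v : B (a *: u) v = a * B u v := formZl (complexify G) a u v.
Let BZr a u v : B u (a *: v) = a * B u v := formZr (complexify G) a u v.

Lemma theta_factorE z u v : theta_factor z u v =
  exp_ipi (- B (psi z *m cx v) (cx v)) * exp_ipi (- (B u (cx v) *+ 2)).
Proof. by rewrite /theta_factor BDl !mulr2n BDl -exp_ipiD -opprD. Qed.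

Lemma theta_factor0 z u : theta_factor z u 0 = 1.
Proof.
by rewrite /theta_factor /formC /complexify map_mx0 form0r oppr0 exp_ipi0.
Qed.

Lemma theta_factor_split z u v : theta_factor z u v =
  theta_factor z 0 v * exp_ipi (- (B u (cx v) *+ 2)).
Proof.
have e0 : theta_factor z 0 v = exp_ipi (- B (psi z *m cx v) (cx v)).
  by rewrite /theta_factor mul0rn addr0.
by rewrite e0 theta_factorE.
Qed.

Lemma theta_factor_neq0 z u v : theta_factor z u v != 0. Proof. exact: exp_ipi_neq0. Qed.

(** A basis of the lattice whose dual lattice has the columns of N as a
    basis. *)
Definition colattice (N : 'M[R]_n) : 'M[R]_n := (invmx N *m invmx G)^T.

Lemma colattice_unit N : N \in unitmx -> colattice N \in unitmx.
Proof. by move=> uN; rewrite unitmx_tr unitmx_mul !unitmx_inv uN. Qed.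

Lemma dual_colattice N (s : R) : N \in unitmx -> s != 0 ->
  dual (lattice (s *: colattice N)) = lattice (s^-1 *: N).
Proof.
move=> uN s0; have us : s \is a GRing.unit by rewrite unitfE.
rewrite dual_latticeE // ?unitmxZ ?colattice_unit //; congr lattice.
rewrite linearZ /= trmxK -scalemxAl mulmxKV // invmxZ ?unitmx_inv //.
  by rewrite invmxK.
by rewrite unitmxZ // unitmx_inv.
Qed.

Lemma theta_dual_sparse N z u : N \in unitmx -> tubeY z ->
  theta G psi (dual (lattice (t.+1%:R *: N))) z u @[t --> \oo] --> (1 : C R).
Proof.
move=> uN zY.
apply: (@theta_sparse _ _ _ _ _ _ td (fun t => dual (lattice (t.+1%:R *: N))) N) => //.
by move=> t; rewrite dual_latticeK // unitmxZ // unitfE pnatr_eq0.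
Qed.

(** Choose lattices L_t, dilated by t, whose duals all contain v.  By (T5) and
    (T2), the two sides of the identity differ by the factor
    theta(j(z), Ju) / theta(j(z), J(u + Zv)) of the series over L_t, which tends
    to 1. *)
Lemma H_cocycle z u v : tubeY z ->
  H z u = theta_factor z u v * H z (u + psi z *m cx v).
Proof.
move=> zY; have [->|v0] := eqVneq v 0.
  by rewrite theta_factor0 mul1r /complexify map_mx0 mulmx0 addr0.
have [i [N [uN Nv]]] := unit_with_column v0.
have uC := colattice_unit uN; have jz := j_tube T5 zY.
pose g w t := theta G psi (dual (lattice (t.+1%:R *: colattice N))) (j z) (J z *m w).
apply: (@lim_eq R _ _ (g (u + psi z *m cx v)) (g u)).
- exact: theta_dual_sparse.
- exact: theta_dual_sparse.
move=> t; have t0 : t.+1%:R != 0 :> R by rewrite pnatr_eq0.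
have ful : full_lattice (lattice (t.+1%:R *: colattice N)).
  by apply: lattice_full; rewrite unitmxZ // unitfE.
have dv : dual (lattice (t.+1%:R *: colattice N)) v.
  rewrite dual_colattice //; exists ((t.+1%:Z) *: delta_mx i 0) => //.
  rewrite map_mxZ map_delta_mx -scalemxAl -scalemxAr scalerA Nv.
  by rewrite mulVf // scale1r.
rewrite /g !(theta_transform T5) // (T2 u ful zY dv) -/(theta_factor z u v).
by ring.
Qed.

(** Since j o j = id, applying (T5) twice compares theta(z,u) with
    theta(z,J'Ju), both of which tend to 1 when the summation lattice becomes
    sparse. *)
Lemma H_involution z u : tubeY z ->
  H (j z) (J z *m u) * H z u = H (j z) 0 * H z 0.
Proof.
move=> zY; have jz := j_tube T5 zY.
pose L t := lattice (t.+1%:R *: (1%:M : 'M[R]_n)).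
have ut t : t.+1%:R *: (1%:M : 'M[R]_n) \in unitmx.
  by rewrite unitmxZ ?unitfE ?pnatr_eq0 ?unitmx1.
have dd t : dual (dual (L t)) = L t by exact: dual_latticeK.
have fL t : full_lattice (L t) by exact: lattice_full.
have fD t : full_lattice (dual (L t)).
  rewrite /L dual_latticeE //; apply: lattice_full.
  by rewrite unitmx_inv unitmx_mul unitmx_tr ut.
have x1 w : theta G psi (dual (L t)) z w @[t --> \oo] --> (1 : C R).
  exact: (theta_dual_sparse w (unitmx1 R n) zY).
clearbody L.
pose x w t := theta G psi (dual (L t)) z w.
pose a t := c (L t) * c (dual (L t)).
have E w t : x (J (j z) *m (J z *m w)) t =
    a t * (H (j z) (J z *m w) * H z w) * x w t.
  have := theta_transform T5 (J z *m w) (fL t) jz.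
  rewrite (j_invol T5 zY) /x => ->.
  have := theta_transform T5 w (fD t) zY; rewrite dd => ->.
  by rewrite /a; ring.
have E0 t := E 0 t; rewrite !mulmx0 in E0.
have {}x1 w : x w @ \oo --> (1 : C R) by exact: x1.
clearbody x a.
apply/esym; apply: (@lim_eq R _ _
  (fun t => x (J (j z) *m (J z *m u)) t * x 0 t) (fun t => x u t * x 0 t)).
- exact: (lim_mul1 (x1 _) (x1 _)).
- exact: (lim_mul1 (x1 _) (x1 _)).
by move=> t; rewrite (E u t) {2}(E0 t); ring.
Qed.

Lemma formC_nondeg (x : 'cV[C R]_n) : (forall v : 'cV[R]_n, B x (cx v) = 0) ->
  x = 0.
Proof.
move=> h; have pos := rho_pos td.
have z (v : 'cV[R]_n) : form G v v = 0 -> v = 0 by exact: form_eq0 pos _.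
rewrite (ReIm_mx x).
have -> : map_mx (@complex.Re R) x = 0.
  by apply: z; have := h (map_mx (@complex.Re R) x); rewrite formC_real_r => -[].
have -> : map_mx (@complex.Im R) x = 0.
  by apply: z; have := h (map_mx (@complex.Im R) x); rewrite formC_real_r => -[].
by rewrite /complexify !map_mx0 scaler0 addr0.
Qed.

Lemma exp_ipi_double (b : C R) :
  (forall s : R, exp_ipi (- ((real_complex R s * b) *+ 2)) = 1) -> b = 0.
Proof.
move=> h; apply: exp_ipi_scale_eq1 => s; rewrite -[RHS](h (- s / 2)).
congr exp_ipi; rewrite rmorphM rmorphN fmorphV rmorph_nat -mulr_natr.
by field.
Qed.

(** If J x = 0, then H(z,u) does not change when u moves along x, by
    [H_involution]; [H_cocycle] then forces rho(x,v) = 0 for all real v. *)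
Lemma J_unit z : tubeY z -> J z \in unitmx.
Proof.
move=> zY; have jz := j_tube T5 zY.
apply: inj_unitmx => x Jx; apply: formC_nondeg => v; apply: exp_ipi_double => s.
have Hs w : H z (real_complex R s *: x + w) = H z w.
  apply: (mulfI (Hfac_neq0 T5 (J z *m w) jz)).
  rewrite (H_involution _ zY) -(H_involution (real_complex R s *: x + w) zY).
  by rewrite mulmxDr -scalemxAr Jx scaler0 add0r.
have := H_cocycle (real_complex R s *: x) v zY.
rewrite Hs -[X in H z X]addr0 Hs (H_cocycle 0 v zY) add0r.
move/(mulIf (Hfac_neq0 T5 _ zY)); rewrite !theta_factorE => /(mulfI (exp_ipi_neq0 _)).
by rewrite -BZl => <-; rewrite /formC form0l mul0rn oppr0 exp_ipi0.
Qed.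

(** The factors of (T2) and of [H_cocycle] are inverse to each other. *)
Lemma theta_period z N w v : tubeY z -> N \in unitmx -> dual (lattice N) v ->
  theta G psi (dual (lattice N)) (j z) (J z *m (w + psi z *m cx v)) =
  theta G psi (dual (lattice N)) (j z) (J z *m w).
Proof.
move=> zY uN dv; have ful := lattice_full uN.
have e1 := theta_transform T5 (w + psi z *m cx v) ful zY.
have e2 := theta_transform T5 w ful zY.
refine (etrans e1 (etrans _ (esym e2))).
have abs (k hw hv a t1 t2 : C R) : t1 = a * t2 -> hw = a * hv ->
    k * hv * t1 = k * hw * t2 by move=> -> ->; ring.
exact: (abs _ _ _ _ _ _ (T2 w ful zY dv) (H_cocycle w v zY)).
Qed.

(** The function u |-> theta(j(z),Ju) has the period Zv and the quasi-period x
    with J x = Z'l.  Moving from 0 to x + Zv in the two possible orders multiplies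
    it by two factors whose ratio is the left-hand side.  To cancel the value at
    0, the lattice is first dilated by some t for which this value is not 0,
    replacing v and l by v/t and t l, which leaves rho(JZv,l) unchanged. *)
Lemma JZ_integral z N v l : tubeY z -> N \in unitmx ->
  dual (lattice N) v -> lattice N l ->
  exp_ipi (- (B (J z *m (psi z *m cx v)) (cx l) *+ 2)) = 1.
Proof.
move=> zY uN dv ll; have jz := j_tube T5 zY.
pose g t := theta G psi (dual (lattice (t.+1%:R *: N))) (j z) 0.
have [t gt] : exists t, g t != 0.
  have /cvgr_dist_lt/(_ _ ltr01) := theta_dual_sparse 0 uN jz.
  move=> h; near \oo => t; exists t; apply/eqP => g0.
  have : `|1 - g t| < 1 by near: t; exact: h.
  by rewrite g0 subr0 normr1 ltxx.
have t0 : t.+1%:R != 0 :> R by rewrite pnatr_eq0.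
set M := t.+1%:R *: N in g gt; have uM : M \in unitmx by rewrite unitmxZ // unitfE.
pose v' := t.+1%:R^-1 *: v; pose l' := t.+1%:R *: l.
have dv' : dual (lattice M) v'.
  move=> _ [k _ <-]; rewrite -scalemxAl formZl formZr mulVKf //.
  by apply: dv; exists k.
have ll' : lattice M l'.
  by case: ll => k _ kl; exists k => //; rewrite /M /l' -kl -scalemxAl.
have -> : B (J z *m (psi z *m cx v)) (cx l) =
    B (J z *m (psi z *m cx v')) (cx l').
  rewrite !complexifyZ -!scalemxAr BZl BZr mulrA -rmorphM mulVf //.
  by rewrite rmorph1 mul1r.
pose x := invmx (J z) *m (psi (j z) *m cx l').
have Jx : J z *m x = psi (j z) *m cx l' by rewrite mulKVmx // J_unit.
have ful : full_lattice (dual (lattice M)).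
  rewrite dual_latticeE //; apply: lattice_full.
  by rewrite unitmx_inv unitmx_mul unitmx_tr uM.
have quasi w : theta G psi (dual (lattice M)) (j z) (w + psi (j z) *m cx l') =
    theta_factor (j z) w l' * theta G psi (dual (lattice M)) (j z) w.
  by apply: T2 => //; rewrite dual_latticeK.
have p1 := theta_period x zY uM dv'.
have p0 := theta_period 0 zY uM dv'.
rewrite mulmx0 add0r in p0.
rewrite mulmxDr Jx addrC quasi p0 -[X in _ = theta _ _ _ _ X]add0r quasi in p1.
move: p1 => /(mulIf gt); rewrite !theta_factorE => /(mulfI (exp_ipi_neq0 _)) ->.
by rewrite /formC form0l mul0rn oppr0 exp_ipi0.
Unshelve. all: by end_near.
Qed.

(** Complete v to a basis N and stretch one of the other basis vectors by an
    arbitrary real factor: by [JZ_integral] every real multiple of the coordinate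
    of JZv along that vector is an integer, so this coordinate is 0.  Thus all
    real vectors are eigenvectors of JZ. *)
Lemma JZ_scalar z : tubeY z -> exists l, J z *m psi z = l%:M.
Proof.
move=> zY; apply: scalar_of_eigen => v; set X := J z *m psi z.
have [->|v0] := eqVneq v 0.
  by exists 0; rewrite /complexify map_mx0 mulmx0 scaler0.
have [i [N [uN Nv]]] := unit_with_column v0.
pose y := invmx (cx N) *m (X *m cx v).
have uNC : cx N \in unitmx by rewrite map_unitmx.
have XE : X *m cx v = cx N *m y by rewrite mulKVmx.
suff y0 k : k != i -> y k 0 = 0.
  exists (y i 0); rewrite XE.
  have yy : y = y i 0 *: cx (delta_mx i 0 : 'cV[R]_n).
    apply/colP => k; rewrite /complexify map_delta_mx [RHS]mxE [X in _ * X]mxE.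
    by have [->|/y0 ->] := eqVneq k i; rewrite ?mulr1 ?mulr0.
  by rewrite {1}yy -scalemxAr -complexifyM Nv.
move=> ki; pose dk : 'cV[R]_n := delta_mx k 0.
(* the k-th coordinate in the basis N is the form against m0 *)
pose m0 : 'cV[R]_n := colattice N *m dk.
have yE : y k 0 = B (X *m cx v) (cx m0).
  have Gm0 : G *m m0 = (invmx N)^T *m dk.
    rewrite /m0 /colattice trmx_mul (trmx_inv G) (rho_sym td) !mulmxA mulmxV //.
    by rewrite mul1mx.
  rewrite /formC /form -mulmxA -complexifyM Gm0 complexifyM mulmxA.
  rewrite {2}/complexify -matrix.map_trmx -trmx_mul map_invmx.
  by rewrite -/(complexify N) -/y /complexify map_delta_mx -colE !mxE.
rewrite yE; apply: exp_ipi_double => s.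
have [->|s0] := eqVneq s 0; first by rewrite rmorph0 mul0r mul0rn oppr0 exp_ipi0.
(* dividing the k-th basis vector by s keeps v in the dual lattice and puts
   s m0 in the lattice *)
pose D (a : R) : 'M[R]_n := diag_mx (\row_b (if b == k then a else 1)).
have DD : D s^-1 *m D s = 1%:M.
  rewrite mulmx_diag -diag_const_mx; congr diag_mx; apply/rowP => b.
  by rewrite !mxE; case: eqP; rewrite ?mulVf ?mulr1.
have Dd a b : D a *m (delta_mx b 0 : 'cV[R]_n) =
    (if b == k then a else 1) *: delta_mx b 0.
  apply/colP => b'; rewrite mul_diag_mx !mxE.
  by have [->|] := eqVneq b' b; rewrite ?mulr0.
pose M := N *m D s^-1.
have MM : M *m (D s *m invmx N) = 1%:M.
  by rewrite /M mulmxA -(mulmxA N) DD mulmx1 mulmxV.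
have [uM _] := mulmx1_unit MM.
have MV : invmx M = D s *m invmx N by rewrite -[RHS](mulKmx uM) MM mulmx1.
have dv : dual (lattice (colattice M)) v.
  rewrite -[colattice M]scale1r dual_colattice ?oner_neq0 // invr1 scale1r.
  exists (delta_mx i 0) => //; rewrite map_delta_mx /M -mulmxA Dd.
  by rewrite eq_sym (negPf ki) scale1r.
have dl : lattice (colattice M) (s *: m0).
  exists (delta_mx k 0) => //; rewrite map_delta_mx /colattice MV -mulmxA trmx_mul.
  by rewrite tr_diag_mx -mulmxA Dd eqxx -scalemxAr.
have := JZ_integral zY (colattice_unit uM) dv dl.
by rewrite complexifyZ BZr mulmxA.
Qed.

(** Let x = J^-1 Z'w.  By [H_involution] and [H_cocycle] at j(z), the function
    H(z,u) is also quasi-periodic for the translation by x.  Comparing with the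
    translation by the real multiples of Zv gives rho(x,v) + rho(JZv,w) = 0, that
    is x = - l w where JZ = l. *)
Lemma psi_j_psi z : tubeY z ->
  exists2 l, l != 0 & psi (j z) *m psi z = l%:M.
Proof.
move=> zY; have jz := j_tube T5 zY; have uJ := J_unit zY.
have [l JZ] := JZ_scalar zY; exists (- l ^+ 2).
  rewrite oppr_eq0 sqrf_eq0; apply/eqP => l0.
  have Z0 : psi z = 0.
    by rewrite -[LHS](mulKmx uJ) JZ l0 raddf0 mulmx0.
  pose i : 'I_n := Ordinal (dim_pos td).
  have d0 : delta_mx i 0 != 0 :> 'cV[R]_n.
    apply/eqP => /colP/(_ i)/eqP; by rewrite !mxE !eqxx oner_eq0.
  have : 0 < form (gram G psi (map_mx (@complex.Im R) z)) (delta_mx i 0) (delta_mx i 0).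
    by move/(cone_gram td): zY; apply.
  rewrite -(form_real_op td) -(Im_psi_mul td) Z0 mul0mx.
  have -> : map_mx (@complex.Im R) (0 : 'cV[C R]_n) = 0.
    by apply/colP => k; rewrite !mxE.
  by rewrite form0l ltxx.
suff ZJ : psi (j z) = - l *: J z.
  by rewrite ZJ -scalemxAl JZ -mul_scalar_mx -scalar_mxM expr2 mulNr.
have key (v w : 'cV[R]_n) :
    B (invmx (J z) *m (psi (j z) *m cx w) + l *: cx w) (cx v) = 0.
  set x := invmx (J z) *m (psi (j z) *m cx w).
  have Jx : J z *m x = psi (j z) *m cx w by rewrite mulKVmx.
  clearbody x.
  have Hx u : H z (u + x) = theta_factor (j z) (J z *m u) w * H z u.
    apply: (mulfI (Hfac_neq0 T5 (J z *m (u + x)) jz)).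
    rewrite H_involution // -(H_involution u zY).
    by rewrite (H_cocycle (J z *m u) w jz) mulmxDr Jx; ring.
  apply: exp_ipi_double => s; pose v' := s *: v.
  have Hxv := Hx (psi z *m cx v').
  rewrite (mulmxA (J z)) JZ mul_scalar_mx addrC in Hxv.
  have Hx0 := Hx 0; rewrite add0r mulmx0 in Hx0.
  have Hv0 := H_cocycle 0 v' zY; rewrite add0r in Hv0.
  have abs (hx h0 hxv hv a b a' b' : C R) : hv != 0 ->
      hx = a * hxv -> h0 = b * hv -> hx = a' * h0 -> hxv = b' * hv ->
      a * b' = a' * b.
    by move=> hv0 e1 e2 + e4; rewrite e1 e2 e4 !mulrA => /(mulIf hv0).
  have := abs _ _ _ _ _ _ _ _ (Hfac_neq0 T5 _ zY) (H_cocycle x v' zY) Hv0 Hx0 Hxv.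
  rewrite (theta_factor_split z x v') (theta_factor_split (j z) (l *: cx v') w).
  have abs2 (a b p q : C R) : a != 0 -> b != 0 -> a * p * (b * q) = b * a ->
      p * q = 1.
    move=> a0 b0 E; apply: (mulfI a0); apply: (mulfI b0).
    by rewrite mulr1 -E; ring.
  move/(abs2 _ _ _ _ (theta_factor_neq0 _ _ _) (theta_factor_neq0 _ _ _)).
  rewrite -exp_ipiD -opprD -mulrnDl => <-; congr (exp_ipi (- (_ *+ 2))).
  have Bs : B (cx v) (cx w) = B (cx w) (cx v).
    by rewrite !formC_cx (form_swap _ _ (rho_sym td)).
  have e1 : B x (cx v') = real_complex R s * B x (cx v).
    by rewrite complexifyZ; exact: BZr.
  have e2 : B (l *: cx v') (cx w) = l * (real_complex R s * B (cx w) (cx v)).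
    by rewrite -Bs complexifyZ; apply: etrans (BZl _ _ _) _; rewrite BZl.
  have e3 : B (x + l *: cx w) (cx v) = B x (cx v) + l * B (cx w) (cx v).
    by apply: etrans (BDl _ _ _) _; congr (_ + _); exact: BZl.
  have abs3 (a b d p q t : C R) : p = a * b -> q = l * (a * d) ->
      t = b + l * d -> p + q = a * t by move=> -> -> ->; ring.
  exact: (esym (abs3 _ _ _ _ _ _ e1 e2 e3)).
have col (w : 'cV[R]_n) : psi (j z) *m cx w = - l *: J z *m cx w.
  have /formC_nondeg/eqP := fun v => key v w.
  rewrite addr_eq0 => /eqP /(congr1 (mulmx (J z))).
  by rewrite mulKVmx // => ->; rewrite mulmxN -scalemxAr scaleNr mulNmx scalemxAl.
apply/matrixP => a b; have := col (delta_mx b 0).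
rewrite /complexify map_delta_mx -!colE => /colP/(_ a).
by rewrite !mxE.
Qed.
End Cocycle.

(** * Inversion and the quadratic operation *)

(** With Y = c - X this is X - X c^-1 X = (X^-1 + (c - X)^-1)^-1. *)
Lemma hua_identity (K : fieldType) n (X Y Xi Yi c : 'M[K]_n) :
  X + Y = c -> c \in unitmx -> Xi *m X = 1%:M -> Yi *m Y = 1%:M ->
  (Xi + Yi) *m (X - X *m invmx c *m X) = 1%:M.
Proof.
move=> XY uc Xi1 Yi1.
have e : X - X *m invmx c *m X = Y *m invmx c *m X.
  have {1}-> : X = c *m invmx c *m X by rewrite mulmxV // mul1mx.
  by rewrite -!mulmxBl -XY addrAC subrr add0r.
rewrite mulmxDl {2}e mulmxBr !mulmxA Xi1 Yi1 !mul1mx.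
by rewrite subrK.
Qed.

Section Closure.
Context (R : realType) (m n : nat) (G : 'M[R]_n).
Context (psi : {linear 'cV[C R]_m -> 'M[C R]_n}) (e : 'cV[R]_m).
Hypothesis td : theta_data G psi e.
Hypothesis inv_C : forall z, tube (theta_cone G psi) z ->
  exists w, psi w *m psi z = 1%:M.

Local Notation cx := (@complexify R _ _).
Local Notation A := (real_op psi).
Local Notation Y := (theta_cone G psi).

(** The hypothesis is used at the point iy of the tube, where psi takes the
    value i psi(y); the real part of the resulting inverse is an inverse. *)
Lemma real_op_inv y : Y y -> exists2 a, Y a & A a *m A y = 1%:M.
Proof.
move=> yY; have zY : tube Y (I_ R *: cx y).
  rewrite /tube /=; suff -> : map_mx (@complex.Im R) (I_ R *: cx y) = y by [].
  by apply/colP => i; rewrite !mxE /= mul0r mul1r add0r.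
have [w] := inv_C zY; pose w' := I_ R *: w.
have -> : psi w *m psi (I_ R *: cx y) = psi w' *m psi (cx y).
  by rewrite /w' !linearZ /= scalemxAl.
rewrite (psi_cx td) {1}(ReIm_mx w') linearD linearZ /= !(psi_cx td) mulmxDl.
rewrite -scalemxAl -!complexifyM => /matrixP E.
set a := map_mx _ w' in E; have Aa : A a *m A y = 1%:M.
  apply/matrixP => i k; have := congr1 (@complex.Re R) (E i k).
  rewrite !mxE /=; set S := \sum_j _; set T := \sum_j _ => e0.
  move: e0; rewrite !(mul0r, mulr0, subr0, addr0, subrr) => ->.
  by case: (i == k).
clear zY; clearbody a; exists a; last exact: Aa.
apply/(cone_gram td) => u u0.
pose v := A a *m u.
have uE : u = A y *m v.
  by rewrite /v mulmxA (mulmx1C Aa) mul1mx.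
have v0 : v != 0 by apply: contra_neq u0 => v0; rewrite uE v0 mulmx0.
rewrite -(form_real_op td) -/v {1}uE (form_swap _ _ (rho_sym td)) (form_real_op td).
by move/(cone_gram td): yY; apply.
Qed.

Lemma coneD a b : Y a -> Y b -> Y (a + b).
Proof.
move=> /(cone_gram td) ha /(cone_gram td) hb; apply/(cone_gram td) => u u0.
rewrite -(form_real_op td) (real_opD td) mulmxDl formDl !(form_real_op td).
by rewrite addr_gt0 ?ha ?hb.
Qed.

Lemma cone_absorb y x : Y y ->
  exists2 s : R, 0 < s & Y (y + s *: x) /\ Y (y - s *: x).
Proof.
move=> /(cone_gram td) hy.
have [c c0 hc] := pd_coercive (gram_sym td y) hy.
pose b := \sum_i \sum_k `|gram G psi x i k|.
have b0 : 0 <= b by rewrite sumr_ge0 // => i _; rewrite sumr_ge0.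
have hb u : `|form (gram G psi x) u u| <= b * norm1 u ^+ 2.
  rewrite /form; apply: le_trans (row_le_norm1 _ _) _.
  rewrite expr2 mulrA; apply: ler_wpM2r; first exact: norm1_ge0.
  rewrite /b exchange_big /= mulr_suml; apply: ler_sum => k _.
  rewrite mxE (le_trans (ler_norm_sum _ _ _)) // mulr_suml.
  apply: ler_sum => i _; rewrite mxE normrM mulrC ler_wpM2l //.
  by rewrite /norm1 (bigD1 i) //= lerDl sumr_ge0.
exists (c / (b + 1)); first by rewrite divr_gt0 // ltr_wpDl.
set s := c / (b + 1).
have s0 : 0 < s by rewrite divr_gt0 // ltr_wpDl.
have key (t : R) : `|t| = s -> Y (y + t *: x).
  move=> ts; apply/(cone_gram td) => u u0.
  rewrite -(form_real_op td) (real_opD td) (real_opZ td) mulmxDl -scalemxAl formDl formZl.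
  rewrite !(form_real_op td).
  have n0 : 0 < norm1 u ^+ 2.
    rewrite exprn_gt0 // lt_def norm1_ge0 andbT; apply: contra_neq u0 => n0.
    apply/colP => i; rewrite mxE; apply/eqP; rewrite -normr_eq0.
    move/eqP: n0; rewrite psumr_eq0 // => /allP/(_ i); rewrite mem_index_enum.
    exact.
  have := hc u; have := hb u => h1 h2.
  have h3 : - (s * (b * norm1 u ^+ 2)) <= t * form (gram G psi x) u u.
    rewrite -ts lerNl -mulNr (le_trans (ler_norm _)) // normrM normrN.
    by rewrite ler_wpM2l.
  have h4 : s * b < c.
    by rewrite /s mulrAC ltr_pdivrMr ?ltr_wpDl // ltr_pM2l // ltrDl.
  have : s * b * norm1 u ^+ 2 < c * norm1 u ^+ 2 by rewrite ltr_pM2r.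
  rewrite -mulrA; lra.
split; first by apply: key; rewrite gtr0_norm.
by rewrite -scaleNr; apply: key; rewrite normrN gtr0_norm.
Qed.

(** Hua's identity applies to X = (y + s x)/2, for s so small that X and y - X
    are both in the cone; expanding X y^-1 X then isolates x y^-1 x. *)
Lemma real_op_quadratic y x : Y y ->
  exists w, A x *m invmx (A y) *m A x = A w.
Proof.
move=> yY; have [s s0 [p1 p2]] := cone_absorb x yY.
have half z : Y z -> Y (2^-1 *: z).
  move=> /(cone_gram td) hz; apply/(cone_gram td) => u u0.
  rewrite -(form_real_op td) (real_opZ td) -scalemxAl formZl (form_real_op td).
  by rewrite mulr_gt0 ?invr_gt0 // hz.
set a := 2^-1 *: (y + s *: x); set b := 2^-1 *: (y - s *: x).
have ab : A a + A b = A y.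
  rewrite -(real_opD td); suff -> : a + b = y by [].
  by apply/colP => i; rewrite !mxE; field.
have [yi _ yy] := real_op_inv yY.
have uy : A y \in unitmx by have [] := mulmx1_unit yy.
have [ai aiY aa] := real_op_inv (half _ p1).
have [bi biY bb] := real_op_inv (half _ p2).
have := hua_identity ab uy aa bb; rewrite -(real_opD td) => hu.
have [d _ dd] := real_op_inv (coneD aiY biY).
have dE : A d = A a - A a *m invmx (A y) *m A a.
  by rewrite -[LHS]mulmx1 -hu mulmxA dd mul1mx.
have aE : A a = 2^-1 *: (A y + s *: A x).
  by rewrite (real_opZ td) (real_opD td) (real_opZ td).
have sq : A a *m invmx (A y) *m A a =
    4^-1 *: (A y + (s *+ 2) *: A x + s ^+ 2 *: (A x *m invmx (A y) *m A x)).
  rewrite aE -!scalemxAl -scalemxAr scalerA.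
  have -> : 2^-1 * 2^-1 = 4^-1 :> R by field.
  congr (_ *: _); rewrite !mulmxDl !mulmxDr -!scalemxAl -!scalemxAr.
  rewrite mulmxV // !mul1mx -!(mulmxA (A x)) mulVmx // mulmx1 scalerA.
  by rewrite -!addrA; congr (_ + _); rewrite addrA -scalerDl mulr2n expr2.
exists ((s ^+ 2)^-1 *: (4 *: (a - d) - (y + (s *+ 2) *: x))).
have -> : A ((s ^+ 2)^-1 *: (4 *: (a - d) - (y + (s *+ 2) *: x))) =
    (s ^+ 2)^-1 *: (4 *: (A a *m invmx (A y) *m A a) - (A y + (s *+ 2) *: A x)).
  have AB u v : A (u - v) = A u - A v.
    by rewrite (real_opD td) -scaleN1r (real_opZ td) scaleN1r.
  rewrite (real_opZ td) AB (real_opZ td) AB (real_opD td) (real_opZ td) dE.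
  by rewrite subKr.
rewrite sq scalerA mulfV ?pnatr_eq0 // scale1r addrAC subrr add0r scalerA.
by rewrite mulVf ?scale1r // expf_neq0 // gt_eqF.
Qed.
End Closure.

Theorem corollary16 (R : realType) :
  ~ exists (n : nat) (G : 'M[R]_n)
      (psi : {linear 'cV[C R]_27 -> 'M[C R]_n}) (e : 'cV[R]_27)
      (j : 'cV[C R]_27 -> 'cV[C R]_27)
      (J : 'cV[C R]_27 -> 'M[C R]_n)
      (H : 'cV[C R]_27 -> 'cV[C R]_n -> C R)
      (c : set 'cV[R]_n -> C R),
    [/\ theta_data G psi e,
        theta_cone G psi = exceptional_cone R &
        [/\ identity_T1 G psi, identity_T2 G psi, identity_T3 G psi,
            identity_T4 G psi & identity_T5 G psi e j J H c]].
Proof.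
move=> [n [G [psi [e [j [J [H [c [td Yexc [_ T2 _ _ T5]]]]]]]]]].
have inv_C z : tube (theta_cone G psi) z -> exists w, psi w *m psi z = 1%:M.
  move=> zY; have [l l0 e1] := psi_j_psi td T2 T5 zY; exists (l^-1 *: j z).
  by rewrite linearZ /= -scalemxAl e1 scale_scalar_mx mulVf.
pose S x := gram G psi x.
have S_lin : linear S.
  by move=> a x y; rewrite /S /gram (real_opD td) (real_opZ td) mulmxDr -scalemxAr.
pose SL := GRing.isLinear.Build R 'cV[R]_27 'M[R]_n *:%R S S_lin.
pose S' : {linear 'cV[R]_27 -> 'M[R]_n} := HB.pack S SL.
have S_cone x : exceptional_cone R x <->
    (forall u : 'cV[R]_n, u != 0 -> 0 < form (S' x) u u).
  by rewrite -Yexc; exact: cone_gram td _.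
have uG := G_unit td.
apply: (@albert_not_special R n S') => //.
- by move=> x; exact: gram_sym td _.
- move=> x S0; apply: (@complexify_inj R 27 1); apply: (psi_inj td).
  have A0 : real_op psi x = 0.
    by rewrite -[LHS](mulKmx uG) -/(gram G psi x) [gram _ _ _]S0 mulmx0.
  rewrite (psi_cx td) A0 /complexify !map_mx0 raddf0 //.
- move=> x; have oneY : theta_cone G psi (herm_one R).
    by rewrite Yexc; exact: herm_one_cone R.
  have [w wE] := real_op_quadratic td inv_C x oneY; exists w.
  have uS : gram G psi (herm_one R) \in unitmx.
    by apply: pd_unit; apply/(cone_gram td).
  have u1 : real_op psi (herm_one R) \in unitmx by rewrite unitmx_mul uG in uS.
  rewrite -[S' w]/(G *m real_op psi w) -wE.
  rewrite -[S' x]/(G *m real_op psi x) -[S' (herm_one R)]/(G *m real_op psi (herm_one R)).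
  rewrite -[LHS]mulmxA.
  have -> : invmx (G *m real_op psi (herm_one R)) *m (G *m real_op psi x) =
      invmx (real_op psi (herm_one R)) *m real_op psi x.
    apply: (can_inj (mulKmx uS)); rewrite mulKVmx // /gram.
    by rewrite -mulmxA (mulmxA (real_op psi (herm_one R))) mulmxV // mul1mx.
  by rewrite !mulmxA.
Qed.
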